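(* Let $(u,u_y)\in C^\infty(\mathbb R/\mathbf p\mathbb Z)\times C^\infty(\mathbb R/\mathbf p\mathbb Z)$ be real Cauchy data (at $y=0$) of a $\mathbf p$-periodic finite type solution of the sinh-Gordon equation $u_{xx}+u_{yy}+2\sinh(2u)=0$. For the series of Hamiltonians $(H_n)_{n\in\mathbb N}$ and the solutions $(\omega_n)_{n\in\mathbb N_0}$ of the homogeneous Jacobi equation from the Pinkall–Sterling iteration one has, for all $n\ge0$, $$\nabla H_{2n+1}=\big(\mathrm{Re}(\omega_n(\cdot,0)),\mathrm{Re}(\partial_y\omega_n(\cdot,0))\big),\qquad \nabla H_{2n+2}=\big(\mathrm{Im}(\omega_n(\cdot,0)),\mathrm{Im}(\partial_y\omega_n(\cdot,0))\big).$$
   Context: **Gradient convention.** With $\Omega((\delta q,\delta p),(\widetilde{\delta q},\widetilde{\delta p}))=\int_0^{\mathbf p}(\delta q\,\widetilde{\delta p}-\widetilde{\delta q}\,\delta p)\,dx$ on $C^\infty_{\mathbf p}\times C^\infty_{\mathbf p}$ (real smooth $\mathbf p$-periodic functions), $\nabla H(u,u_y)$ denotes the pair of functions determined by $$\frac{d}{dt}H\big((u,u_y)+t(\delta u,\delta u_y)\big)\Big|_{t=0}=\Omega\big(\nabla H(u,u_y),(\delta u,\delta u_y)\big)\quad\text{for all }(\delta u,\delta u_y).$$ **Hamiltonians.** Let $\partial_z=\frac12(\partial_x-i\partial_y)$, so $u_z=\frac12(u_x-iu_y)$. Let $$U_\lambda=\frac12\begin{pmatrix}-iu_y & i\lambda^{-1}e^u+ie^{-u}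 \\ i\lambda e^u+ie^{-u} & iu_y\end{pmatrix},$$ $\frac{d}{dx}F_\lambda=F_\lambda U_\lambda$, $F_\lambda(0)=\mathbb 1$, $M_\lambda=F_\lambda(\mathbf p)$ with eigenvalues $\mu^{\pm1}$. As $\lambda\to0$ there is an asymptotic expansion $$\ln\mu=\frac{1}{\sqrt\lambda}\frac{i\mathbf p}{2}+\sqrt\lambda\sum_{n\ge0}c_n\lambda^n,$$ and $H_{2n+1}:=(-1)^{n+1}\mathrm{Re}(c_n)$, $H_{2n+2}:=(-1)^{n+1}\mathrm{Im}(c_n)$ for $n\ge0$. The coefficients are functionals of $(u,u_y)$: $c_n=\int_0^{\mathbf p}(b_{2n+1})_{11}\,dx$, where $b_m$ (diagonal) and $a_m$ (off-diagonal) are the unique matrix functions solving, as formal power series in $\sqrt\lambda$, $$\beta_\lambda\Big(\mathbb 1+\sum_{m\ge1}a_m\sqrt\lambda^{\,m}\Big)+\sum_{m\ge1}a_m'\sqrt\lambda^{\,m}=\Big(\mathbb 1+\sum_{m\ge1}a_m\sqrt\lambda^{\,m}\Big)\sum_{m\ge-1}b_m\sqrt\lambda^{\,m},$$ with $$\beta_\lambda=\tfrac{1}{\sqrt\lambda}\begin{pmatrix}\frac i2 & 0 \\ 0 & -\frac i2\end{pmatrix}+\begin{pmatrix}0 & -u_z \\ -u_z & 0\end{pmatrix}+\sqrt\lambda\,\tfrac i2\begin{pmatrix}\cosh 2u & -\sinh 2u \\ \sinh 2u & -\cosh 2u\end{pmatrix}.$$ For example $c_0=\int_0^{\mathbf p}\big(-i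 u_z^2+\frac i2\cosh(2u)\big)dx$. **Pinkall–Sterling iteration.** $\omega_0=u_z$; given $\omega_n$ (a polynomial in $u_z,u_{zz},\dots$), let $\phi_n$ be the polynomial in $u_z,u_{zz},u_{zzz},\dots$ without constant term satisfying $\partial_z\phi_n=\omega_{n,zz}-2u_z\omega_{n,z}$, and set $\omega_{n+1}=\partial_z\phi_n+2u_z\phi_n$. Thus $\omega_1=u_{zzz}-2u_z^3$, $\omega_2=u_{zzzzz}-10u_{zzz}u_z^2-10u_{zz}^2u_z+6u_z^5$. Each $\omega_n$ solves $\Delta\omega_n+4\cosh(2u)\omega_n=0$. On $y=0$, all $y$-derivatives of $u$ of order $\ge2$ are expressed through $x$-derivatives of $u$ and $u_y$ by means of the sinh-Gordon equation. **Finite type** means that there are $g\in\mathbb N_0$ and periodic $\tilde\omega_n,\tau_n,\sigma_n$ such that $\Phi_\lambda=\frac{\lambda^{-1}}2\begin{pmatrix}0 & ie^u \\ 0 & 0\end{pmatrix}+\sum_{n=0}^g\lambda^n\begin{pmatrix}\tilde\omega_n & e^u\tau_n \\ e^u\sigma_n & -\tilde\omega_n\end{pmatrix}$ satisfies $\frac{d}{dx}\Phi_\lambda=[\Phi_\lambda,U_\lambda]$. *)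

(* Defs.v *)
From Stdlib Require Import Reals.
From Coquelicot Require Export Coquelicot.
Open Scope R_scope.

Definition periodic {T : Type} (p : R) (f : R -> T) : Prop :=
  forall x, f (x + p) = f x.

Definition smooth_periodic (p : R) (f : R -> R) : Prop :=
  (forall n x, ex_derive_n f n x) /\ periodic p f.

Definition Omega (p : R) (dq dp dq' dp' : R -> R) : R :=
  RInt (fun x => dq x * dp' x - dq' x * dp x) 0 p.

(* The pair (f, g) is the gradient of H at (q, r) with respect to Omega. *)
Definition is_gradient (p : R) (H : (R -> R) -> (R -> R) -> R)
    (q r f g : R -> R) : Prop :=
  smooth_periodic p f /\ smooth_periodic p g /\
  forall dq dr, smooth_periodic p dq -> smooth_periodic p dr ->
    is_derive (fun t => H (fun x => q x + t * dq x) (fun x => r x + t * dr x))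
              0 (Omega p f g dq dr).

(* Solutions live on a strip |y| < eps around the line y = 0 carrying the
   Cauchy data; global solutions on the plane restrict to such strips. *)
Definition sinh_gordon_solution (p eps : R) (u : R -> R -> R) : Prop :=
  forall x y, Rabs y < eps ->
    (forall n, ex_diff_n u n x y) /\
    u (x + p) y = u x y /\
    Derive_n (fun t => u t y) 2 x + Derive_n (fun t => u x t) 2 y
      + 2 * sinh (2 * u x y) = 0.

Definition is_cauchy_data (u : R -> R -> R) (q r : R -> R) : Prop :=
  forall x, q x = u x 0 /\ r x = Derive (fun y => u x y) 0.

Definition Cexp (z : C) : C :=
  (exp (Re z) * cos (Im z), exp (Re z) * sin (Im z)).

Notation M2 := (@matrix C 2 2).

Definition mat2 (a b c d : C) : M2 :=
  mk_matrix 2 2 (fun i j => match i, j with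
                            | O, O => a | O, _ => b
                            | _, O => c | _, _ => d end).

Definition entry (A : M2) (i j : nat) : C := coeff_mat (RtoC 0) A i j.

Definition is_derive_M2 (A : R -> M2) (x : R) (A' : M2) : Prop :=
  forall i j, (i < 2)%nat -> (j < 2)%nat ->
    is_derive (V := C_R_NormedModule) (fun t => entry (A t) i j) x (entry A' i j).

Definition bracket (A B : M2) : M2 := Mplus (Mmult A B) (Mopp (Mmult B A)).

Definition eigenvalue (A : M2) (mu : C) : Prop :=
  exists v : @matrix C 2 1,
    v <> Mzero /\
    Mmult A v = mk_matrix 2 1 (fun i j => (mu * coeff_mat (RtoC 0) v i j)%C).

Definition U_mat (q r : R -> R) (lam : C) (x : R) : M2 :=
  (mat2 (- (Ci * r x) / 2)
        ((Ci * / lam * exp (q x) + Ci * exp (- q x)) / 2)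
        ((Ci * lam * exp (q x) + Ci * exp (- q x)) / 2)
        (Ci * r x / 2))%C.

Definition is_monodromy (p : R) (q r : R -> R) (lam : C) (M : M2) : Prop :=
  exists F : R -> M2,
    F 0 = Mone /\
    (forall x, is_derive_M2 F x (Mmult (F x) (U_mat q r lam x))) /\
    F p = M.

Definition finite_type (p : R) (q r : R -> R) : Prop :=
  exists (g : nat) (om tau sig : nat -> R -> C),
    (forall n, (n <= g)%nat ->
       periodic p (om n) /\ periodic p (tau n) /\ periodic p (sig n)) /\
    let Phi (lam : C) (x : R) : M2 :=
      Mplus (mat2 0 (/ lam * (Ci * exp (q x)) / 2)%C 0 0)
            (sum_n (fun n => mat2 (lam ^ n * om n x)%C
                                  (lam ^ n * (exp (q x) * tau n x))%C
                                  (lam ^ n * (exp (q x) * sig n x))%C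
                                  (lam ^ n * - om n x)%C) g) in
    forall (lam : C) (x : R), lam <> 0 ->
      is_derive_M2 (Phi lam) x (bracket (Phi lam x) (U_mat q r lam x)).

(* c lists the coefficients of the asymptotic expansion of ln mu as lambda -> 0.
   The variable s is sqrt lambda, and L s is a logarithm of one of the two
   eigenvalues of the monodromy at lambda = s ^ 2.  The logarithm is chosen
   pointwise, because for general data the branch points of mu accumulate at
   lambda = 0; for imaginary s the two eigenvalues are exponentially
   separated, hence c is uniquely determined. *)
Definition log_mu_expansion (p : R) (q r : R -> R) (c : nat -> C) : Prop :=
  exists L : C -> C,
    (forall s : C, s <> 0 ->
       exists M, is_monodromy p q r (s ^ 2)%C M /\ eigenvalue M (Cexp (L s))) /\
    forall N : nat, exists K delta : R, 0 < delta /\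
      forall s : C, s <> 0 -> Cmod s < delta ->
        Cmod (L s - (/ s * (Ci * p / 2)
                     + s * sum_n (fun n => c n * (s ^ 2) ^ n) N))%C
        <= K * Cmod s ^ (2 * N + 3).

(* beta q r k is the coefficient of s ^ (k - 1) in beta_lambda, s = sqrt lambda. *)
Definition beta (q r : R -> R) (k : nat) (x : R) : M2 :=
  let uz : C := ((Derive q x - Ci * r x) / 2)%C in
  match k with
  | 0%nat => mat2 (Ci / 2)%C 0 0 (- (Ci / 2))%C
  | 1%nat => mat2 0 (- uz)%C (- uz)%C 0
  | 2%nat => mat2 (Ci / 2 * cosh (2 * q x))%C (- (Ci / 2 * sinh (2 * q x)))%C
                  (Ci / 2 * sinh (2 * q x))%C (- (Ci / 2 * cosh (2 * q x)))%C
  | _ => Mzero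
  end.

(* Formal solution of beta (1 + sum a_m s^m) + sum a_m' s^m
   = (1 + sum a_m s^m) (sum b_m s^m).  Here a 0 is the identity and, as the
   b-series starts at m = -1, b k stands for b_(k-1); the last clause compares
   the coefficients of s ^ (k - 1). *)
Definition formal_diagonalization (q r : R -> R) (a b : nat -> R -> M2) : Prop :=
  (forall x, a 0%nat x = Mone) /\
  (forall m x, (1 <= m)%nat -> entry (a m x) 0 0 = 0 /\ entry (a m x) 1 1 = 0) /\
  (forall k x, entry (b k x) 0 1 = 0 /\ entry (b k x) 1 0 = 0) /\
  exists da : nat -> R -> M2,
    (forall m x, is_derive_M2 (a m) x (da m x)) /\
    forall k x,
      Mplus (sum_n (fun i => Mmult (beta q r i x) (a (k - i)%nat x)) k)
            (match k with 0%nat => Mzero | S m => da m x end)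
      = sum_n (fun j => Mmult (a j x) (b (k - j)%nat x)) k.

(* The functionals c_n: coefficients of the expansion of ln mu, with
   c_n = int_0^p (b_(2n+1))_11 dx. *)
Definition hamiltonian_coefficients (p : R)
    (c : nat -> (R -> R) -> (R -> R) -> C) : Prop :=
  forall q r, smooth_periodic p q -> smooth_periodic p r ->
    log_mu_expansion p q r (fun n => c n q r) /\
    forall a b, formal_diagonalization q r a b ->
      forall n, c n q r = RInt (V := C_R_CompleteNormedModule)
                               (fun x => entry (b (2 * n + 2)%nat x) 0 0) 0 p.

(* H_(2n+1) = (-1)^(n+1) Re c_n and H_(2n+2) = (-1)^(n+1) Im c_n. *)
Definition hamiltonian (c : nat -> (R -> R) -> (R -> R) -> C) (k : nat)
    (q r : R -> R) : R :=
  let n := Nat.div2 (k - 1) in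
  (-1) ^ (n + 1) * (if Nat.odd k then Re (c n q r) else Im (c n q r)).

(* Differential polynomials in u: Jet k stands for the (k+1)-st z-derivative
   of u, so Jet 0 is u_z. *)
Inductive dpoly : Type :=
  | Cst (a : C)
  | Jet (k : nat)
  | Add (P Q : dpoly)
  | Mul (P Q : dpoly).

Fixpoint deval (v : nat -> C) (P : dpoly) : C :=
  match P with
  | Cst a => a
  | Jet k => v k
  | Add P Q => (deval v P + deval v Q)%C
  | Mul P Q => (deval v P * deval v Q)%C
  end.

Fixpoint Dz (P : dpoly) : dpoly :=
  match P with
  | Cst _ => Cst 0
  | Jet k => Jet (S k)
  | Add P Q => Add (Dz P) (Dz Q)
  | Mul P Q => Add (Mul (Dz P) Q) (Mul P (Dz Q))
  end.

(* Equality of polynomials; as C is infinite it can be tested on values. *)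
Definition dpoly_eq (P Q : dpoly) : Prop := forall v, deval v P = deval v Q.

Definition no_constant_term (P : dpoly) : Prop := deval (fun _ => RtoC 0) P = 0.

Definition pinkall_sterling (omega phi : nat -> dpoly) : Prop :=
  dpoly_eq (omega 0%nat) (Jet 0) /\
  forall n,
    no_constant_term (phi n) /\
    dpoly_eq (Dz (phi n))
             (Add (Dz (Dz (omega n)))
                  (Mul (Cst (-2)) (Mul (Jet 0) (Dz (omega n))))) /\
    dpoly_eq (omega (S n))
             (Add (Dz (phi n)) (Mul (Cst 2) (Mul (Jet 0) (phi n)))).

Definition d_x (f : R -> R -> C) (x y : R) : C :=
  (Derive (fun t => Re (f t y)) x, Derive (fun t => Im (f t y)) x).

Definition d_y (f : R -> R -> C) (x y : R) : C :=
  (Derive (fun t => Re (f x t)) y, Derive (fun t => Im (f x t)) y).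

Definition d_z (f : R -> R -> C) (x y : R) : C :=
  ((d_x f x y - Ci * d_y f x y) / 2)%C.

Definition dpoly_at (u : R -> R -> R) (P : dpoly) (x y : R) : C :=
  deval (fun k => Nat.iter (S k) d_z (fun s t => RtoC (u s t)) x y) P.

(* Main.v *)
From Stdlib Require Import Reals Lra Lia FunctionalExtensionality.
From Coquelicot Require Import Coquelicot.
Require Import Defs.
Open Scope R_scope.
Set Bullet Behavior "Strict Subproofs".

(** Write [s] for the square root of [lambda].  The connection [beta_lambda] is
gauged by [1 + a] to the diagonal [b], so the functional whose expansion
coefficients are the [c_n] is the integral of [b_11], and its first variation
is the integral of [tr (delta beta . Q)], where [Q] is the conjugate of the
projector [diag (1, 0)] by [1 + a].  In the basis
[2 Q = 1 + A sigma_3 + B sigma_1 + C (i sigma_2)], the projector property reads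
[A^2 + B^2 - C^2 = 1], and [Q] solves the Lax equation [Q' = [Q, beta]].  Since
[delta beta] contains [delta u] and [delta u_y] only, an integration by parts
turns the variation into the pairing of [(delta u, delta u_y)] with a multiple
of [B] and of the [y]-derivative of [B].

It remains to recognise the coefficients of [B].  Along the complex direction
[z], the Lax equation is
[s B_z = -i C], [s C_z = -2 s u_z A - i B], [A_z = -2 u_z C], and this is the
Pinkall-Sterling iteration: its solution is
[B = 2 i sum (-1)^n omega_n s^(2n+1)], [C = i s B_z] and
[A = 1 + 2 sum (-1)^n (omega_n,z - phi_n) s^(2n+2)].  The normalisation of
[phi_n] gives [A^2 + B^2 - C^2 = 1]: the [z]-derivative of the left side
vanishes, so it is a constant polynomial ([Dz_zero_const]), and its value at
zero is [1] ([hat_conserved]).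

The series from the iteration also satisfy the Lax equation in the conjugate
direction ([zb_flow]).  The defect satisfies the linearised [z]-equations and
the linearised constraint, and such a defect cannot have a lowest nonzero
coefficient ([conserved_vanish]); here the sinh-Gordon equation enters, as the
flatness of the connection.  Adding both directions gives the Lax equation along
[x].  Its normalised solution is unique, by the same argument on the lowest
coefficient ([lax_frame_unique]), so the two [B] agree.

The formal diagonalization is given by two scalar Riccati equations,
[gamma] for the entry 21 of [a] and one more for the entry 12.  Instead of
inverting [1 + a], the projector is written through [gamma] and the solution [h]
of the linear equation adjoint to the linearised Riccati equation:
[A = 1 - 2 h gamma], [B = h + gamma - h gamma^2], [C = h - gamma + h gamma^2].
The derivative of [h delta gamma] is then exactly the difference of
[delta b_11] and [tr (delta beta . Q)] ([first_variation]).

All series have coefficients in a syntactic differential ring [dexpr] generated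
by the jets of the data, [cosh 2u] and [sinh 2u].  Thus all derivations are
structural, they commute where the jets do, and the same expressions can be
evaluated on a solution (second variable [y]) and on a line of Cauchy data
(second variable [t]). *)

(** * Formal power series *)

(** The Cauchy product by recursion on the first factor: the ring laws become
simple inductions, and the same recursion makes sense for syntactic
coefficients, which satisfy no ring law up to equality. *)
Fixpoint cauchy {A : Type} (add mul : A -> A -> A) (n : nat) (f g : nat -> A) : A :=
  match n with
  | O => mul (f O) (g O)
  | S m => add (mul (f O) (g (S m))) (cauchy add mul m (fun k => f (S k)) g)
  end.

(** Causality of the product, which makes recursive definitions of series
possible. *)
Lemma cauchy_local {A : Type} (add mul : A -> A -> A) n :
  forall f f' g g' : nat -> A,
  (forall k, (k <= n)%nat -> f k = f' k) ->
  (forall k, (k <= n)%nat -> g k = g' k) ->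
  cauchy add mul n f g = cauchy add mul n f' g'.
Proof.
  induction n as [|n IH]; intros f f' g g' Hf Hg; simpl.
  - now rewrite Hf, Hg by lia.
  - rewrite (Hf 0%nat), (Hg (S n)) by lia. f_equal.
    apply IH; intros k Hk; [apply Hf | apply Hg]; lia.
Qed.

Lemma cauchy_morph {A B : Type} (add mul : A -> A -> A) (add' mul' : B -> B -> B)
    (F : A -> B) :
  (forall a b, F (add a b) = add' (F a) (F b)) ->
  (forall a b, F (mul a b) = mul' (F a) (F b)) ->
  forall n f g,
  F (cauchy add mul n f g) = cauchy add' mul' n (fun k => F (f k)) (fun k => F (g k)).
Proof.
  intros Ha Hm n; induction n as [|n IH]; intros f g; simpl.
  - apply Hm.
  - now rewrite Ha, Hm, IH.
Qed.

Definition ps := nat -> C.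

Definition pmul (f g : ps) : ps := fun n => cauchy Cplus Cmult n f g.
Definition padd (f g : ps) : ps := fun n => (f n + g n)%C.
Definition popp (f : ps) : ps := fun n => (- f n)%C.
Definition pconst (a : C) : ps := fun n => match n with O => a | S _ => RtoC 0 end.
Arguments pconst a%_C.
Definition psvar : ps := fun n => match n with 1%nat => RtoC 1 | _ => RtoC 0 end.

Lemma cauchy_leibniz {A : Type} (add mul : A -> A -> A) (F D : A -> C) :
  (forall a b, F (add a b) = (F a + F b)%C) ->
  (forall a b, F (mul a b) = (F a * F b)%C) ->
  (forall a b, D (add a b) = (D a + D b)%C) ->
  (forall a b, D (mul a b) = (D a * F b + F a * D b)%C) ->
  forall n f g,
  D (cauchy add mul n f g) =
  (pmul (fun k => D (f k)) (fun k => F (g k)) n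
   + pmul (fun k => F (f k)) (fun k => D (g k)) n)%C.
Proof.
  intros Fa Fm Da Dm n; unfold pmul; induction n as [|n IH]; intros f g; simpl.
  - apply Dm.
  - rewrite Da, Dm, IH. ring.
Qed.

Lemma pmul_sum_n f g n : pmul f g n = sum_n (fun i => (f i * g (n - i)%nat)%C) n.
Proof.
  unfold pmul; revert f; induction n as [|n IH]; intros f.
  - now rewrite sum_O.
  - unfold sum_n; rewrite sum_Sn_m by lia; rewrite <- sum_n_m_S.
    simpl cauchy; rewrite (IH (fun k => f (S k))); reflexivity.
Qed.

Lemma pmul_const_l a f n : pmul (pconst a) f n = (a * f n)%C.
Proof.
  unfold pmul; destruct n as [|n]; simpl; [ring|].
  assert (H : forall m g, cauchy Cplus Cmult m (fun _ => RtoC 0) g = RtoC 0).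
  { induction m as [|m IH]; intros g; simpl; [ring|]. rewrite IH; ring. }
  rewrite H; ring.
Qed.

Lemma pmul_var_O f : pmul psvar f O = RtoC 0.
Proof. unfold pmul; simpl; ring. Qed.

Lemma pmul_var_S f n : pmul psvar f (S n) = f n.
Proof.
  transitivity (RtoC 0 * f (S n) + pmul (pconst 1) f n)%C.
  - reflexivity.
  - rewrite pmul_const_l; ring.
Qed.

Lemma pmul_add_l f g h : pmul (padd f g) h = padd (pmul f h) (pmul g h).
Proof.
  extensionality n; unfold pmul, padd; revert f g.
  induction n as [|n IH]; intros f g; simpl; [ring|].
  rewrite (IH (fun k => f (S k)) (fun k => g (S k))); ring.
Qed.

Lemma pmul_scal_l a f h n : pmul (fun k => (a * f k)%C) h n = (a * pmul f h n)%C.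
Proof.
  unfold pmul; revert f; induction n as [|n IH]; intros f; simpl; [ring|].
  rewrite (IH (fun k => f (S k))); ring.
Qed.

Lemma pmul_comm f g : pmul f g = pmul g f.
Proof.
  assert (R : forall n f g, pmul f g (S n)
              = (f (S n) * g O + pmul f (fun k => g (S k)) n)%C).
  { unfold pmul; induction n as [|n IH]; intros f' g'; simpl in *; [ring|].
    rewrite (IH (fun k => f' (S k)) g'); ring. }
  extensionality n; revert f g.
  induction n as [|n IH]; intros f g; [unfold pmul; simpl; ring|].
  rewrite R, IH. unfold pmul; simpl; ring.
Qed.

Lemma pmul_assoc f g h : pmul f (pmul g h) = pmul (pmul f g) h.
Proof.
  extensionality n; revert f g.
  induction n as [|n IH]; intros f g; [unfold pmul; simpl; ring|].
  change (f O * pmul g h (S n) + pmul (fun k => f (S k)) (pmul g h) n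
          = pmul f g O * h (S n)
            + pmul (padd (fun k => (f O * g (S k))%C) (pmul (fun k => f (S k)) g)) h n)%C.
  rewrite pmul_add_l; unfold padd at 1; rewrite pmul_scal_l, <- IH.
  unfold pmul; simpl; ring.
Qed.

Lemma ps_ring : ring_theory (pconst 0) (pconst 1) padd pmul
  (fun f g => padd f (popp g)) popp eq.
Proof.
  assert (Z : forall n, pconst 0 n = RtoC 0) by now intros [|n].
  constructor; intros; try apply pmul_comm; try apply pmul_assoc;
    try apply pmul_add_l; try reflexivity; extensionality n;
    try rewrite pmul_const_l; unfold padd, popp; rewrite ?Z; ring.
Qed.

Add Ring ps_ring : ps_ring.

Declare Scope ps_scope.
Delimit Scope ps_scope with ps.
Bind Scope ps_scope with ps.
Infix "+" := padd : ps_scope.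
Infix "*" := pmul : ps_scope.
Notation "- f" := (popp f) : ps_scope.
Notation "f - g" := (padd f (popp g)) : ps_scope.
Notation "0" := (pconst 0) : ps_scope.
Notation "1" := (pconst 1) : ps_scope.
Notation "2" := (padd (pconst 1) (pconst 1)) : ps_scope.
Notation "'s" := psvar : ps_scope.
Notation "'I" := (pconst Ci) : ps_scope.

(** * Complex-valued functions of a real variable *)

Definition cder (f : R -> C) (x : R) (l : C) : Prop :=
  is_derive (fun t => Re (f t)) x (Re l) /\ is_derive (fun t => Im (f t)) x (Im l).

Lemma cder_is_derive f x l :
  cder f x l -> is_derive (V := C_R_NormedModule) f x l.
Proof.
  intros [Hr Hi].
  apply (is_derive_scal_l (V := C_R_NormedModule) _ _ _ (RtoC 1)) in Hr.
  apply (is_derive_scal_l (V := C_R_NormedModule) _ _ _ Ci) in Hi.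
  generalize (is_derive_plus _ _ _ _ _ Hr Hi).
  assert (E : forall z : C, plus (G := C_R_NormedModule)
      (scal (V := C_R_NormedModule) (Re z) (RtoC 1))
      (scal (V := C_R_NormedModule) (Im z) Ci) = z).
  { intros [a b]; rewrite !scal_R_Cmult.
    change (RtoC a * 1 + RtoC b * Ci = (a, b))%C.
    apply injective_projections; simpl; ring. }
  rewrite E; apply is_derive_ext; intros t; apply E.
Qed.

Lemma cder_unique f x l l' : cder f x l -> cder f x l' -> l = l'.
Proof.
  intros [H1 H2] [H3 H4].
  rewrite (surjective_pairing l), (surjective_pairing l').
  apply is_derive_unique in H1, H2, H3, H4.
  unfold Re, Im in *; congruence.
Qed.

Lemma cder_ext f g x l : (forall t, f t = g t) -> cder f x l -> cder g x l.
Proof.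
  intros E [H1 H2]; split; [revert H1 | revert H2]; apply is_derive_ext;
    intros t; now rewrite E.
Qed.

Lemma cder_eq f x l m : l = m -> cder f x l -> cder f x m.
Proof. now intros ->. Qed.

Lemma cder_const a x : cder (fun _ => a) x 0.
Proof. split; apply (@is_derive_const R_AbsRing R_NormedModule). Qed.

Lemma cder_real f x l : is_derive f x l -> cder (fun t => RtoC (f t)) x l.
Proof. intros H; split; [exact H | apply (@is_derive_const R_AbsRing R_NormedModule 0)]. Qed.

Lemma cder_plus f g x l m :
  cder f x l -> cder g x m -> cder (fun t => f t + g t)%C x (l + m)%C.
Proof. intros [H1 H2] [H3 H4]; split; now apply @is_derive_plus. Qed.

Lemma is_derive_Rmult (f g : R -> R) x l m :
  is_derive f x l -> is_derive g x m ->
  is_derive (fun t => f t * g t) x (l * g x + f x * m).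
Proof.
  intros Hf Hg; apply (is_derive_mult f g x l m Hf Hg); intros; apply Rmult_comm.
Qed.

Lemma cder_mult f g x l m :
  cder f x l -> cder g x m -> cder (fun t => f t * g t)%C x (l * g x + f x * m)%C.
Proof.
  intros [H1 H2] [H3 H4]; split.
  - apply (is_derive_ext (fun t => Re (f t) * Re (g t) - Im (f t) * Im (g t)));
      [reflexivity|].
    replace (Re _) with ((Re l * Re (g x) + Re (f x) * Re m)
      - (Im l * Im (g x) + Im (f x) * Im m)) by (unfold Re, Im; simpl; ring).
    apply @is_derive_minus; apply is_derive_Rmult; assumption.
  - apply (is_derive_ext (fun t => Re (f t) * Im (g t) + Im (f t) * Re (g t)));
      [reflexivity|].
    replace (Im _) with ((Re l * Im (g x) + Re (f x) * Im m)
      + (Im l * Re (g x) + Im (f x) * Re m)) by (unfold Re, Im; simpl; ring).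
    apply @is_derive_plus; apply is_derive_Rmult; assumption.
Qed.

(** * Differential expressions *)

(** [J i j k] stands for the [j]-th [x]-derivative and [k]-th derivative in the
second variable of the first ([i = 0]) or second datum, [Ch] and [Sh] for the
hyperbolic cosine and sine of twice the first datum. *)
Inductive atom : Type := J (i j k : nat) | Ch | Sh.

Inductive dexpr : Type :=
  | Con (a : C)
  | Atm (a : atom)
  | Plus (e f : dexpr)
  | Times (e f : dexpr).

Definition env := nat -> nat -> nat -> R -> R -> R.

Definition ev_atom (V : env) (a : atom) (x y : R) : C :=
  match a with
  | J i j k => V i j k x y
  | Ch => cosh (2 * V 0%nat 0%nat 0%nat x y)
  | Sh => sinh (2 * V 0%nat 0%nat 0%nat x y)
  end.

Fixpoint ev (V : env) (e : dexpr) (x y : R) : C :=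
  match e with
  | Con a => a
  | Atm a => ev_atom V a x y
  | Plus e f => (ev V e x y + ev V f x y)%C
  | Times e f => (ev V e x y * ev V f x y)%C
  end.

(** A vector field is given by its values on the jets; the chain rule extends it to
[Ch] and [Sh]. *)
Definition vfield (X : nat -> nat -> nat -> dexpr) (a : atom) : dexpr :=
  match a with
  | J i j k => X i j k
  | Ch => Times (Con 2) (Times (Atm Sh) (X 0 0 0)%nat)
  | Sh => Times (Con 2) (Times (Atm Ch) (X 0 0 0)%nat)
  end.

Fixpoint D (X : nat -> nat -> nat -> dexpr) (e : dexpr) : dexpr :=
  match e with
  | Con _ => Con 0
  | Atm a => vfield X a
  | Plus e f => Plus (D X e) (D X f)
  | Times e f => Plus (Times (D X e) f) (Times e (D X f))
  end.

Definition shift_x i j k := Atm (J i (S j) k).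
Definition shift_y i j k := Atm (J i j (S k)).
Definition shift_z i j k :=
  Times (Con (/ 2)) (Plus (shift_x i j k) (Times (Con (- Ci)) (shift_y i j k))).
Definition shift_zb i j k :=
  Times (Con (/ 2)) (Plus (shift_x i j k) (Times (Con Ci) (shift_y i j k))).

Notation D_x := (D shift_x).
Notation D_y := (D shift_y).
Notation D_z := (D shift_z).
Notation D_zb := (D shift_zb).

(** Commuting derivations need to be compared on jets only. *)
Lemma D_commute V X Y x y :
  (forall i j k, ev V (D X (Y i j k)) x y = ev V (D Y (X i j k)) x y) ->
  forall e, ev V (D X (D Y e)) x y = ev V (D Y (D X e)) x y.
Proof.
  intros H; induction e as [a|a|e IHe f IHf|e IHe f IHf]; simpl.
  - reflexivity.
  - destruct a; simpl; [apply H | rewrite H; ring | rewrite H; ring].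
  - now rewrite IHe, IHf.
  - rewrite IHe, IHf; ring.
Qed.

Lemma D_z_xy V e x y : ev V (D_z e) x y = ((ev V (D_x e) x y - Ci * ev V (D_y e) x y) / 2)%C.
Proof.
  induction e as [a|a|e IHe f IHf|e IHe f IHf]; simpl;
    [field | | rewrite IHe, IHf; field | rewrite IHe, IHf; field].
  destruct a; simpl; field.
Qed.

Lemma D_zb_xy V e x y :
  ev V (D_zb e) x y = ((ev V (D_x e) x y + Ci * ev V (D_y e) x y) / 2)%C.
Proof.
  induction e as [a|a|e IHe f IHf|e IHe f IHf]; simpl;
    [field | | rewrite IHe, IHf; field | rewrite IHe, IHf; field].
  destruct a; simpl; field.
Qed.

Definition jets (w : R) (V : env) : Prop :=
  forall i j k x y, Rabs y < w ->
    is_derive (fun t => V i j k t y) x (V i (S j) k x y) /\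
    is_derive (fun t => V i j k x t) y (V i j (S k) x y).

Lemma is_derive_cosh x : is_derive cosh x (sinh x).
Proof. apply is_derive_Reals, derivable_pt_lim_cosh. Qed.

Lemma is_derive_sinh x : is_derive sinh x (cosh x).
Proof. apply is_derive_Reals, derivable_pt_lim_sinh. Qed.

Lemma is_derive_double (F F' f : R -> R) x l :
  (forall t, is_derive F t (F' t)) -> is_derive f x l ->
  is_derive (fun t => F (2 * f t)) x (2 * (F' (2 * f x) * l)).
Proof.
  intros HF Hf.
  replace (2 * (F' (2 * f x) * l)) with ((2 * l) * F' (2 * f x)) by ring.
  apply (is_derive_comp F (fun t => 2 * f t)); [apply HF|].
  now apply (is_derive_scal f x 2 l).
Qed.

Lemma ev_dx w V e x y : jets w V -> Rabs y < w ->
  cder (fun t => ev V e t y) x (ev V (D_x e) x y).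
Proof.
  intros HV Hy; induction e as [a|a|e IHe f IHf|e IHe f IHf]; simpl.
  - apply cder_const.
  - destruct a as [i j k| |]; simpl.
    + apply cder_real, (proj1 (HV i j k x y Hy)).
    + rewrite <- !RtoC_mult.
      apply cder_real, (is_derive_double cosh sinh (fun t => V 0 0 0 t y)%nat);
        [apply is_derive_cosh | apply (proj1 (HV _ _ _ x y Hy))].
    + rewrite <- !RtoC_mult.
      apply cder_real, (is_derive_double sinh cosh (fun t => V 0 0 0 t y)%nat);
        [apply is_derive_sinh | apply (proj1 (HV _ _ _ x y Hy))].
  - now apply cder_plus.
  - now apply (cder_mult (fun t => ev V e t y) (fun t => ev V f t y)).
Qed.

Lemma ev_dy w V e x y : jets w V -> Rabs y < w ->
  cder (fun t => ev V e x t) y (ev V (D_y e) x y).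
Proof.
  intros HV Hy; induction e as [a|a|e IHe f IHf|e IHe f IHf]; simpl.
  - apply cder_const.
  - destruct a as [i j k| |]; simpl.
    + apply cder_real, (proj2 (HV i j k x y Hy)).
    + rewrite <- !RtoC_mult.
      apply cder_real, (is_derive_double cosh sinh (fun t => V 0 0 0 x t)%nat);
        [apply is_derive_cosh | apply (proj2 (HV _ _ _ x y Hy))].
    + rewrite <- !RtoC_mult.
      apply cder_real, (is_derive_double sinh cosh (fun t => V 0 0 0 x t)%nat);
        [apply is_derive_sinh | apply (proj2 (HV _ _ _ x y Hy))].
  - now apply cder_plus.
  - now apply (cder_mult (fun t => ev V e x t) (fun t => ev V f x t)).
Qed.
(** * Series of expressions and formal Riccati equations *)

Definition dseries := nat -> dexpr.

Definition evs (V : env) (f : dseries) (x y : R) : ps := fun n => ev V (f n) x y.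
Definition smul (f g : dseries) : dseries := fun n => cauchy Plus Times n f g.
Definition sadd (f g : dseries) : dseries := fun n => Plus (f n) (g n).
Definition sscal (a : C) (f : dseries) : dseries := fun n => Times (Con a) (f n).
Definition Ds (X : nat -> nat -> nat -> dexpr) (f : dseries) : dseries := fun n => D X (f n).

Lemma evs_add V f g x y : evs V (sadd f g) x y = (evs V f x y + evs V g x y)%ps.
Proof. reflexivity. Qed.

Lemma evs_scal V a f x y : evs V (sscal a f) x y = (pconst a * evs V f x y)%ps.
Proof. extensionality n; now rewrite pmul_const_l. Qed.

Lemma evs_mul V f g x y : evs V (smul f g) x y = (evs V f x y * evs V g x y)%ps.
Proof.
  extensionality n; unfold evs, smul, pmul.
  now apply (cauchy_morph Plus Times Cplus Cmult (fun e => ev V e x y)).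
Qed.

Lemma evs_D_add V X f g x y :
  evs V (Ds X (sadd f g)) x y = (evs V (Ds X f) x y + evs V (Ds X g) x y)%ps.
Proof. reflexivity. Qed.

Lemma evs_D_scal V X a f x y :
  evs V (Ds X (sscal a f)) x y = (pconst a * evs V (Ds X f) x y)%ps.
Proof. extensionality n; rewrite pmul_const_l; unfold evs, Ds; simpl; ring. Qed.

Lemma evs_D_mul V X f g x y :
  evs V (Ds X (smul f g)) x y =
  (evs V (Ds X f) x y * evs V g x y + evs V f x y * evs V (Ds X g) x y)%ps.
Proof.
  extensionality n; unfold evs, Ds, smul.
  now apply (cauchy_leibniz Plus Times (fun e => ev V e x y)
               (fun e => ev V (D X e) x y)).
Qed.

(** Every recursion for coefficients is turned into an identity of series in this
way, and is then treated by [ring]. *)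
Lemma eq_shift (f g : ps) : f O = 0 -> (forall n, f (S n) = g n) -> f = ('s * g)%ps.
Proof.
  intros H0 HS; extensionality n; destruct n as [|n].
  - now rewrite pmul_var_O.
  - now rewrite pmul_var_S.
Qed.

(** The recursion equivalent to [s f' = a f + s (P f^2 + L f + R)]. *)
Definition riccati_step (a : C) (P L R : dseries) (f : dseries) : dseries :=
  fun n => Times (Con (/ a))
    (Plus (D_x (f n))
       (Times (Con (-1)) (Plus (smul P (smul f f) n) (Plus (smul L f n) (R n))))).

Definition riccati (a : C) (P L R f : dseries) : Prop :=
  f O = Con 0 /\ forall n, f (S n) = riccati_step a P L R f n.

(** The coefficient [n + 1] depends on the coefficients up to [n] only. *)
Lemma riccati_exists a P L R : exists f, riccati a P L R f.
Proof.
  (* [F m] has the correct coefficients up to order [m]. *)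
  set (F := fix F (m : nat) : dseries :=
    match m with
    | O => fun _ => Con 0
    | S m' => fun k => if Nat.eqb k (S m') then riccati_step a P L R (F m') m'
                       else F m' k
    end).
  assert (HF : forall m k, (k <= m)%nat -> F m k = F k k).
  { induction m as [|m IH]; intros k Hk.
    - now replace k with O by lia.
    - simpl F at 1; destruct (Nat.eqb_spec k (S m)) as [->|Hne].
      + simpl; now rewrite Nat.eqb_refl.
      + apply IH; lia. }
  exists (fun k => F k k); split; [reflexivity|].
  intros n; simpl F at 1; rewrite Nat.eqb_refl.
  unfold riccati_step, smul.
  rewrite (cauchy_local Plus Times n L L (F n) (fun k => F k k)) by auto.
  rewrite (cauchy_local Plus Times n P P
             (fun j => cauchy Plus Times j (F n) (F n))
             (fun j => cauchy Plus Times j (fun k => F k k) (fun k => F k k)));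
    [reflexivity | reflexivity |].
  intros k Hk; apply cauchy_local; intros j Hj; apply HF; lia.
Qed.

Section Riccati.

Variables (a : C) (P L R f : dseries).
Hypothesis (Ha : a <> 0) (Hf : riccati a P L R f).

Lemma riccati_evs V x y :
  ('s * evs V (Ds shift_x f) x y =
   pconst a * evs V f x y
   + 's * (evs V P x y * evs V f x y * evs V f x y
           + evs V L x y * evs V f x y + evs V R x y))%ps.
Proof.
  destruct Hf as [H0 HS].
  enough (E : (pconst a * evs V f x y = 's * (evs V (Ds shift_x f) x y
     - evs V (sadd (smul P (smul f f)) (sadd (smul L f) R)) x y))%ps).
  { rewrite E, !evs_add, !evs_mul; ring. }
  apply eq_shift.
  - rewrite pmul_const_l; unfold evs; rewrite H0; simpl; ring.
  - intros n; rewrite pmul_const_l; unfold evs at 1; rewrite HS.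
    unfold padd, popp, evs, Ds, sadd, riccati_step; simpl; field; exact Ha.
Qed.

(** The recursion is an equality of syntactic expressions, so that any derivation
applies to it and yields the linearised Riccati equation. *)
Lemma riccati_evs_D V X x y :
  ('s * evs V (Ds X (Ds shift_x f)) x y =
   pconst a * evs V (Ds X f) x y
   + 's * (evs V (Ds X P) x y * evs V f x y * evs V f x y
           + 2 * evs V P x y * evs V f x y * evs V (Ds X f) x y
           + evs V (Ds X L) x y * evs V f x y + evs V L x y * evs V (Ds X f) x y
           + evs V (Ds X R) x y))%ps.
Proof.
  destruct Hf as [H0 HS].
  enough (E : (pconst a * evs V (Ds X f) x y = 's * (evs V (Ds X (Ds shift_x f)) x y
     - evs V (Ds X (sadd (smul P (smul f f)) (sadd (smul L f) R))) x y))%ps).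
  { rewrite E, !evs_D_add, !evs_D_mul, !evs_mul; ring. }
  apply eq_shift.
  - rewrite pmul_const_l; unfold evs, Ds; rewrite H0; simpl; ring.
  - intros n; rewrite pmul_const_l; unfold evs at 1, Ds at 1; rewrite HS.
    unfold padd, popp, evs, Ds, sadd, riccati_step; simpl; field; exact Ha.
Qed.

End Riccati.
(** * Vanishing of series by induction on the order *)

Definition below (n : nat) (f : ps) : Prop := forall k, (k < n)%nat -> f k = 0.

Lemma below_mul n f g : below n g -> below n (f * g)%ps.
Proof.
  intros Hg k Hk; unfold pmul.
  rewrite (cauchy_local _ _ k f f g (fun _ => RtoC 0)); auto.
  - clear; revert f; induction k as [|k IH]; intros f; simpl; [ring|].
    rewrite IH; ring.
  - intros j Hj; apply Hg; lia.
Qed.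

Lemma below_add n f g : below n f -> below n g -> below n (f + g)%ps.
Proof. intros Hf Hg k Hk; unfold padd; rewrite Hf, Hg by easy; ring. Qed.

Lemma below_s n f : below n f -> below (S n) ('s * f)%ps.
Proof.
  intros Hf [|k] Hk; [apply pmul_var_O|].
  rewrite pmul_var_S; apply Hf; lia.
Qed.

Lemma mul_lowest f g n : below n g -> (f * g)%ps n = (f O * g n)%C.
Proof.
  intros Hg; unfold pmul; destruct n as [|n]; simpl; [reflexivity|].
  change (cauchy Cplus Cmult n (fun k => f (S k)) g)
    with (pmul (fun k => f (S k)) g n).
  rewrite (below_mul (S n) _ _ Hg) by lia; ring.
Qed.

(** A defect [(RA, RB, RC)] tangent to the quadric [A^2 + B^2 - C^2 = const] is
determined by [RB] and [RC], as [X] starts with a nonzero constant and [Y], [Z]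
with zero; the induction on the order needs no constant of integration. *)
Lemma conserved_vanish {T : Type} (X Y Z RA RB RC : T -> ps) (a : C) :
  a <> 0 ->
  (forall t, X t O = a) -> (forall t, Y t O = 0) -> (forall t, Z t O = 0) ->
  (forall t, X t * RA t + Y t * RB t - Z t * RC t = 0)%ps ->
  (forall n, (forall t, below n (RA t) /\ below n (RB t) /\ below n (RC t)) ->
     forall t, below (S n) (RB t) /\ below (S n) (RC t)) ->
  forall n t, below n (RA t) /\ below n (RB t) /\ below n (RC t).
Proof.
  intros Ha HX HY HZ HR Hstep n; induction n as [|n IH].
  { intros t; repeat split; intros k Hk; lia. }
  intros t; destruct (Hstep n IH t) as [HB HC]; repeat split; try assumption.
  intros k Hk; destruct (Nat.eq_dec k n) as [->|Hne];
    [|destruct (IH t) as [HA _]; apply HA; lia].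
  assert (E := f_equal (fun f => f n) (HR t)); unfold padd, popp in E.
  rewrite (mul_lowest (X t)), (mul_lowest (Y t)), (mul_lowest (Z t)), HX, HY, HZ in E
    by (apply IH).
  assert (E' : (a * RA t n)%C = 0).
  { etransitivity; [|etransitivity; [exact E|]]; [ring | now destruct n]. }
  destruct (Ceq_dec (RA t n) 0) as [H0|H0]; [exact H0|].
  now destruct (Cmult_neq_0 a (RA t n)).
Qed.

Lemma I_sqr : ('I * 'I = - (1))%ps.
Proof.
  extensionality n; rewrite pmul_const_l; unfold popp.
  destruct n; simpl; [|ring]. unfold Cmult, Copp; simpl; f_equal; ring.
Qed.

(** * Uniqueness for the Lax equation *)

(** The equations for [B] and [C] of [Q' = [Q, beta]], multiplied by [s].  The
constraint replaces the equation for [A]. *)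
Definition lax_frame (w ch sh : R -> C) (A B C : R -> ps) : Prop :=
  exists B' C' : R -> ps,
    (forall x n, cder (fun t => B t n) x (B' x n)) /\
    (forall x n, cder (fun t => C t n) x (C' x n)) /\
    (forall x,
       's * B' x = - ('I * 's * 's * pconst (sh x) * A x)
                   - ('I + 'I * 's * 's * pconst (ch x)) * C x)%ps /\
    (forall x,
       's * C' x = - (2 * 's * pconst (w x) * A x)
                   - ('I + 'I * 's * 's * pconst (ch x)) * B x)%ps /\
    (forall x, A x * A x + B x * B x - C x * C x = 1)%ps /\
    (forall x, A x O = 1).

Lemma cder_zero_fun f x l : (forall t, f t = RtoC 0) -> cder f x l -> l = 0.
Proof.
  intros H Hl; eapply cder_unique; [exact Hl|].
  apply (cder_ext (fun _ => RtoC 0)); [auto | apply cder_const].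
Qed.

Lemma cder_minus f g x l m :
  cder f x l -> cder g x m -> cder (fun t => f t - g t)%C x (l - m)%C.
Proof. intros [H1 H2] [H3 H4]; split; now apply @is_derive_minus. Qed.

Lemma lax_frame_order_0 w ch sh A B C : lax_frame w ch sh A B C ->
  forall x, B x O = 0 /\ C x O = 0.
Proof.
  intros (B' & C' & _ & _ & HB & HC & _) x.
  assert (Z : forall f : ps, f = ('s * ('I * f))%ps -> f O = 0).
  { intros f ->; apply pmul_var_O. }
  split.
  - assert (E : (B x = 's * ('I * (C' x + 2 * pconst (w x) * A x
                   + 'I * 's * pconst (ch x) * B x)))%ps).
    { transitivity ('I * ('s * C' x) + 's * ('I * (2 * pconst (w x) * A x
                   + 'I * 's * pconst (ch x) * B x)))%ps; [|ring].
      rewrite HC. ring [I_sqr]. }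
    rewrite E; apply pmul_var_O.
  - assert (E : (C x = 's * ('I * (B' x + 'I * 's * pconst (sh x) * A x
                   + 'I * 's * pconst (ch x) * C x)))%ps).
    { transitivity ('I * ('s * B' x) + 's * ('I * ('I * 's * pconst (sh x) * A x
                   + 'I * 's * pconst (ch x) * C x)))%ps; [|ring].
      rewrite HB. ring [I_sqr]. }
    rewrite E; apply pmul_var_O.
Qed.

(** The difference of two solutions solves the linear equations and is tangent to
the quadric at the sum of the solutions. *)
Lemma lax_frame_unique w ch sh A B C A2 B2 C2 :
  lax_frame w ch sh A B C -> lax_frame w ch sh A2 B2 C2 ->
  forall x n, A x n = A2 x n /\ B x n = B2 x n /\ C x n = C2 x n.
Proof.
  intros H H2 x n.
  assert (O1 := lax_frame_order_0 _ _ _ _ _ _ H).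
  assert (O2 := lax_frame_order_0 _ _ _ _ _ _ H2).
  destruct H as (B' & C' & dB & dC & HB & HC & HN & HA).
  destruct H2 as (B2' & C2' & dB2 & dC2 & HB2 & HC2 & HN2 & HA2).
  assert (V : below (S n) (A x - A2 x)%ps /\ below (S n) (B x - B2 x)%ps
              /\ below (S n) (C x - C2 x)%ps).
  { apply (conserved_vanish (fun x => A x + A2 x)%ps (fun x => B x + B2 x)%ps
      (fun x => C x + C2 x)%ps (fun x => A x - A2 x)%ps (fun x => B x - B2 x)%ps
      (fun x => C x - C2 x)%ps 2).
    - intros E; injection E; lra.
    - intros t; unfold padd; rewrite HA, HA2; ring.
    - intros t; unfold padd; destruct (O1 t) as [-> _], (O2 t) as [-> _]; ring.
    - intros t; unfold padd; destruct (O1 t) as [_ ->], (O2 t) as [_ ->]; ring.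
    - intros t.
      transitivity ((A t * A t + B t * B t - C t * C t)
                    - (A2 t * A2 t + B2 t * B2 t - C2 t * C2 t))%ps; [ring|].
      rewrite HN, HN2; ring.
    - intros m Hm t.
      assert (ZB : below m (B' t - B2' t)%ps).
      { intros k Hk; apply (cder_zero_fun (fun t => B t k - B2 t k)%C t).
        - intros t'; apply Hm; lia.
        - now apply cder_minus. }
      assert (ZC : below m (C' t - C2' t)%ps).
      { intros k Hk; apply (cder_zero_fun (fun t => C t k - C2 t k)%C t).
        - intros t'; apply Hm; lia.
        - now apply cder_minus. }
      destruct (Hm t) as (RA & RB & RC); split.
      + assert (E : (B t - B2 t = 's * ('I * ((C' t - C2' t)
                 + 2 * pconst (w t) * (A t - A2 t)
                 + 'I * 's * pconst (ch t) * (B t - B2 t))))%ps).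
        { transitivity ('I * ('s * C' t - 's * C2' t)
            + 's * ('I * (2 * pconst (w t) * (A t - A2 t)
                 + 'I * 's * pconst (ch t) * (B t - B2 t))))%ps; [|ring].
          rewrite HC, HC2; ring [I_sqr]. }
        rewrite E; apply below_s, below_mul.
        apply below_add; [apply below_add; [exact ZC|]|]; now apply below_mul.
      + assert (E : (C t - C2 t = 's * ('I * ((B' t - B2' t)
                 + 'I * 's * pconst (sh t) * (A t - A2 t)
                 + 'I * 's * pconst (ch t) * (C t - C2 t))))%ps).
        { transitivity ('I * ('s * B' t - 's * B2' t)
            + 's * ('I * ('I * 's * pconst (sh t) * (A t - A2 t)
                 + 'I * 's * pconst (ch t) * (C t - C2 t))))%ps; [|ring].
          rewrite HB, HB2; ring [I_sqr]. }
        rewrite E; apply below_s, below_mul.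
        apply below_add; [apply below_add; [exact ZB|]|]; now apply below_mul. }
  assert (Z : forall f g : ps, below (S n) (f - g)%ps -> f n = g n).
  { intros f g Hfg; specialize (Hfg n (Nat.lt_succ_diag_r n)).
    unfold padd, popp in Hfg.
    transitivity (f n + - g n + g n)%C; [ring | rewrite Hfg; ring]. }
  destruct V as (VA & VB & VC); auto.
Qed.
(** * The formal diagonalization *)

Definition uz : dexpr :=
  Times (Con (/ 2)) (Plus (Atm (J 0 1 0)) (Times (Con (- Ci)) (Atm (J 1 0 0)))).

(** With these series the entries 12 and 21 of [s beta] are [s P] and [- s R], and
twice the entry 11 is [i + s L]. *)
Definition ricP : dseries := fun n =>
  match n with
  | O => Times (Con (-1)) uz
  | 1%nat => Times (Con (- Ci / 2)) (Atm Sh)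
  | _ => Con 0
  end.

Definition ricR : dseries := fun n =>
  match n with
  | O => uz
  | 1%nat => Times (Con (- Ci / 2)) (Atm Sh)
  | _ => Con 0
  end.

Definition ricL : dseries := fun n =>
  match n with 1%nat => Times (Con Ci) (Atm Ch) | _ => Con 0 end.

(** The entries [beta_11 + beta_12 gamma] and [beta_22 + beta_21 alpha] of [b],
multiplied by [s]. *)
Definition diag11 (g : dseries) : dseries := fun n =>
  match n with
  | O => Con (Ci / 2)
  | S m => Plus (Times (Con (/ 2)) (ricL m)) (smul ricP g m)
  end.

Definition diag22 (a : dseries) : dseries := fun n =>
  match n with
  | O => Con (- Ci / 2)
  | S m => Plus (Times (Con (- / 2)) (ricL m)) (Times (Con (-1)) (smul ricR a m))
  end.

(** The ring tactic knows no division: this rewrites the factors one half. *)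
Lemma half_twice : (pconst (/ RtoC 2) * 2 = 1)%ps.
Proof.
  extensionality n; rewrite pmul_const_l; unfold padd; destruct n; simpl; field.
Qed.

Lemma pconst_add a b : pconst (a + b) = (pconst a + pconst b)%ps.
Proof. extensionality n; unfold padd; destruct n; simpl; ring. Qed.

Lemma pconst_mul a b : pconst (a * b) = (pconst a * pconst b)%ps.
Proof. extensionality n; rewrite pmul_const_l; destruct n; simpl; ring. Qed.

Lemma pconst_opp a : pconst (- a) = (- pconst a)%ps.
Proof. extensionality n; unfold popp; destruct n; simpl; ring. Qed.

Lemma split_order_0 (f g : ps) (a : C) :
  f O = a -> (forall n, f (S n) = g n) -> f = (pconst a + 's * g)%ps.
Proof.
  intros H0 HS; extensionality n; unfold padd; destruct n as [|n].
  - rewrite pmul_var_O; simpl; rewrite H0; ring.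
  - rewrite pmul_var_S; simpl; rewrite HS; ring.
Qed.

Lemma evs_diag11 V g x y :
  evs V (diag11 g) x y =
  (pconst (Ci / RtoC 2) + 's * (pconst (/ RtoC 2) * evs V ricL x y
                           + evs V ricP x y * evs V g x y))%ps.
Proof.
  apply split_order_0; [reflexivity|]; intros n.
  rewrite <- evs_mul, <- evs_scal; reflexivity.
Qed.

Lemma evs_diag22 V a x y :
  evs V (diag22 a) x y =
  (pconst (- Ci / RtoC 2) + 's * (pconst (- / RtoC 2) * evs V ricL x y
                           - evs V ricR x y * evs V a x y))%ps.
Proof.
  apply split_order_0; [reflexivity|]; intros n.
  rewrite <- evs_mul, <- evs_scal; unfold evs, padd, popp, sscal; simpl; ring.
Qed.

Lemma entry_mat2 a b c d i j : (i < 2)%nat -> (j < 2)%nat ->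
  entry (mat2 a b c d) i j =
  match i, j with O, O => a | O, _ => b | _, O => c | _, _ => d end.
Proof. intros Hi Hj; apply (coeff_mat_bij (RtoC 0)); assumption. Qed.

Lemma matrix_ext (A B : M2) :
  (forall i j, (i < 2)%nat -> (j < 2)%nat -> entry A i j = entry B i j) -> A = B.
Proof. intros H; apply (coeff_mat_ext_aux (RtoC 0) (RtoC 0)), H. Qed.

Lemma entry_Mplus (A B : M2) i j : (i < 2)%nat -> (j < 2)%nat ->
  entry (Mplus A B) i j = (entry A i j + entry B i j)%C.
Proof. intros Hi Hj; apply (coeff_mat_bij (RtoC 0)); assumption. Qed.

Lemma entry_Mmult (A B : M2) i j : (i < 2)%nat -> (j < 2)%nat ->
  entry (Mmult A B) i j = (entry A i 0 * entry B 0 j + entry A i 1 * entry B 1 j)%C.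
Proof.
  intros Hi Hj; etransitivity; [apply (coeff_mat_bij (RtoC 0)); assumption|].
  simpl Init.Nat.pred; rewrite sum_Sn, sum_O; reflexivity.
Qed.

Lemma entry_cauchy (A B : nat -> M2) k i j : (i < 2)%nat -> (j < 2)%nat ->
  entry (sum_n (fun l => Mmult (A l) (B (k - l)%nat)) k) i j =
  (((fun l => entry (A l) i 0) : ps) * (fun l => entry (B l) 0 j)
   + ((fun l => entry (A l) i 1) : ps) * (fun l => entry (B l) 1 j))%ps k.
Proof.
  intros Hi Hj; unfold padd; rewrite !pmul_sum_n.
  assert (E : forall n (M : nat -> M2), entry (sum_n M n) i j
                                = sum_n (fun l => entry (M l) i j) n).
  { induction n as [|n IH]; intros M; [now rewrite !sum_O|].
    rewrite !sum_Sn, <- IH; apply entry_Mplus; assumption. }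
  rewrite E.
  rewrite (sum_n_ext _ _ k (fun l => entry_Mmult (A l) (B (k - l)%nat) i j Hi Hj)).
  apply (sum_n_plus (G := C_AbelianMonoid)).
Qed.

Lemma beta_series V w x y : jets w V -> Rabs y < w ->
  let q := fun x => V 0%nat 0%nat 0%nat x y in
  let r := fun x => V 1%nat 0%nat 0%nat x y in
  (fun l => entry (beta q r l x) 0 0) =
    (pconst (Ci / RtoC 2) + 's * (pconst (/ RtoC 2) * evs V ricL x y))%ps /\
  (fun l => entry (beta q r l x) 0 1) = ('s * evs V ricP x y)%ps /\
  (fun l => entry (beta q r l x) 1 0) = ('s * - evs V ricR x y)%ps /\
  (fun l => entry (beta q r l x) 1 1) =
    (pconst (- Ci / RtoC 2) + 's * (pconst (- / RtoC 2) * evs V ricL x y))%ps.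
Proof.
  intros HV Hy q r.
  assert (Hq : Derive q x = V 0%nat 1%nat 0%nat x y)
    by (apply is_derive_unique, HV, Hy).
  assert (Z : forall i j, (i < 2)%nat -> (j < 2)%nat ->
            entry (@Mzero C_AbelianMonoid 2 2) i j = RtoC 0).
  { intros i j Hi Hj; apply (coeff_mat_bij (RtoC 0)); assumption. }
  repeat split; (apply split_order_0 || apply eq_shift); intros;
    try rewrite pmul_const_l; try destruct n as [|[|n]]; unfold beta;
    rewrite ?Hq; rewrite ?entry_mat2, ?Z by lia; unfold popp, evs; simpl;
    unfold q, r; try field.
Qed.

Lemma Ci_neq_0 : Ci <> 0.
Proof. intros E; injection E; lra. Qed.

Lemma opp_Ci_neq_0 : (- Ci)%C <> 0.
Proof. intros E; injection E; lra. Qed.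

(** The entries 21 and 12 of the gauge equation are the two Riccati equations, and
its diagonal entries define [b]. *)
Lemma formal_diagonalization_jets w V y (g a : dseries) :
  jets w V -> Rabs y < w ->
  riccati Ci ricP ricL ricR g ->
  riccati (- Ci) (sscal (-1) ricR) (sscal (-1) ricL) (sscal (-1) ricP) a ->
  formal_diagonalization (fun x => V 0%nat 0%nat 0%nat x y)
    (fun x => V 1%nat 0%nat 0%nat x y)
    (fun m x => match m with O => Mone
                | S _ => mat2 0 (ev V (a m) x y) (ev V (g m) x y) 0 end)
    (fun m x => mat2 (ev V (diag11 g m) x y) 0 0 (ev V (diag22 a m) x y)).
Proof.
  intros HV Hy Hg Ha.
  set (A := fun (m : nat) x => match m with O => Mone
                | S _ => mat2 0 (ev V (a m) x y) (ev V (g m) x y) 0 end).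
  set (B := fun (m : nat) x => mat2 (ev V (diag11 g m) x y) 0 0 (ev V (diag22 a m) x y)).
  assert (HA : forall m x i j, (i < 2)%nat -> (j < 2)%nat -> entry (A m x) i j =
    match i, j with O, O => pconst 1 m | O, _ => evs V a x y m
                  | _, O => evs V g x y m | _, _ => pconst 1 m end).
  { intros [|m] x i j Hi Hj; unfold A.
    - etransitivity; [apply (coeff_mat_bij (RtoC 0)); assumption|].
      unfold evs; rewrite (proj1 Hg), (proj1 Ha).
      destruct i as [|[|i]], j as [|[|j]]; try lia; reflexivity.
    - rewrite entry_mat2 by assumption. now destruct i, j. }
  split; [|split; [|split]].
  - reflexivity.
  - intros [|m] x Hm; [lia|]; now rewrite !entry_mat2 by lia.
  - intros k x; unfold B; now rewrite !entry_mat2 by lia.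
  - exists (fun m x => mat2 0 (evs V (Ds shift_x a) x y m)
                            (evs V (Ds shift_x g) x y m) 0); split.
    + intros m x i j Hi Hj; apply cder_is_derive.
      rewrite entry_mat2 by assumption.
      eapply cder_ext; [intros t; symmetry; now apply HA|].
      destruct i, j; try (apply cder_const); now apply (ev_dx w).
    + intros k x.
      destruct (beta_series V w x y HV Hy) as (E00 & E01 & E10 & E11).
      set (dA := match k with O => _ | S _ => _ end).
      assert (HdA : forall i j, (i < 2)%nat -> (j < 2)%nat -> entry dA i j =
        match i, j with O, O => pconst 0 k | O, _ => ('s * evs V (Ds shift_x a) x y)%ps k
        | _, O => ('s * evs V (Ds shift_x g) x y)%ps k | _, _ => pconst 0 k end).
      { intros i j Hi Hj; unfold dA; destruct k as [|k].
        - rewrite !pmul_var_O.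
          etransitivity; [apply (coeff_mat_bij (RtoC 0)); assumption|].
          now destruct i, j.
        - rewrite !pmul_var_S, entry_mat2 by assumption. now destruct i, j. }
      assert (Ric := riccati_evs Ci ricP ricL ricR g Ci_neq_0 Hg V x y).
      assert (Rica := riccati_evs (- Ci) _ _ _ a opp_Ci_neq_0 Ha V x y).
      rewrite !evs_scal, !pconst_opp in Rica.
      apply matrix_ext; intros i j Hi Hj.
      rewrite entry_Mplus, HdA by assumption.
      etransitivity; [apply (f_equal (fun z => (z + _)%C));
        exact (entry_cauchy (fun l => beta _ _ l x) (fun l => A l x) k i j Hi Hj)|].
      etransitivity; [|symmetry;
        exact (entry_cauchy (fun l => A l x) (fun l => B l x) k i j Hi Hj)].
      assert (EA : forall i j, (i < 2)%nat -> (j < 2)%nat ->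
        (fun l => entry (A l x) i j) = match i, j with O, O => pconst 1
           | O, _ => evs V a x y | _, O => evs V g x y | _, _ => pconst 1 end).
      { intros i' j' Hi' Hj'; extensionality l; rewrite HA by assumption.
        now destruct i', j'. }
      assert (EB : forall i j, (i < 2)%nat -> (j < 2)%nat ->
        (fun l => entry (B l x) i j) = match i, j with O, O => evs V (diag11 g) x y
           | O, _ => pconst 0 | _, O => pconst 0 | _, _ => evs V (diag22 a) x y end).
      { intros i' j' Hi' Hj'; extensionality l; unfold B.
        rewrite entry_mat2 by assumption. now destruct i', j', l. }
      rewrite !EA, !EB by lia.
      rewrite evs_diag11, evs_diag22.
      replace (- Ci / 2)%C with (- (Ci / 2))%C in * by field.
      rewrite !pconst_opp in *.
      assert (EL : evs V ricL x y = (pconst (/ RtoC 2) * evs V ricL x y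
                                     + pconst (/ RtoC 2) * evs V ricL x y)%ps).
      { transitivity (pconst (/ RtoC 2) * 2 * evs V ricL x y)%ps; [|ring].
        rewrite half_twice; ring. }
      assert (EI : pconst Ci = (pconst (Ci / RtoC 2) + pconst (Ci / RtoC 2))%ps)
        by (rewrite <- pconst_add; f_equal; field).
      assert (E1 : pconst (-1) = (- (1))%ps)
        by (rewrite <- pconst_opp; f_equal; ring).
      rewrite E1 in Rica; clear E1.
      assert (Eo : (- pconst (/ RtoC 2) * evs V ricL x y
                    = - (pconst (/ RtoC 2) * evs V ricL x y))%ps) by ring.
      rewrite Eo in *; clear Eo; rewrite EI in Ric, Rica.
      set (M := (pconst (/ RtoC 2) * evs V ricL x y)%ps) in *.
      clearbody M; rewrite EL in Ric, Rica.
      destruct i as [|[|i]], j as [|[|j]]; try lia; rewrite ?E00, ?E01, ?E10, ?E11;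
        apply (f_equal (fun F : ps => F k) (x := (_ + _)%ps)).
      * ring.
      * rewrite Rica; ring.
      * rewrite Ric; ring.
      * ring.
Qed.
(** * The Lax frame of the formal diagonalization *)

Definition sone : dseries := fun n => match n with O => Con 1 | S _ => Con 0 end.

(** The components of the projector onto the first column of [1 + a] along the
second one; its entry 12 is [h]. *)
Definition frameA (g h : dseries) : dseries := sadd sone (sscal (-2) (smul h g)).
Definition frameB (g h : dseries) : dseries :=
  sadd h (sadd g (sscal (-1) (smul h (smul g g)))).
Definition frameC (g h : dseries) : dseries :=
  sadd h (sadd (sscal (-1) g) (smul h (smul g g))).

Lemma pconst_neg1 : pconst (-1) = (- (1))%ps.
Proof. rewrite <- pconst_opp; f_equal; ring. Qed.

Lemma pconst_neg2 : pconst (-2) = (- (2))%ps.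
Proof. rewrite <- pconst_add, <- pconst_opp; f_equal; ring. Qed.

Lemma evs_sone V x y : evs V sone x y = pconst 1.
Proof. extensionality n; now destruct n. Qed.

Lemma evs_D_sone V X x y : evs V (Ds X sone) x y = pconst 0.
Proof. extensionality n; now destruct n. Qed.

Lemma evs_frame V g h x y :
  evs V (frameA g h) x y = (1 - 2 * evs V h x y * evs V g x y)%ps /\
  evs V (frameB g h) x y =
    (evs V h x y + evs V g x y - evs V h x y * evs V g x y * evs V g x y)%ps /\
  evs V (frameC g h) x y =
    (evs V h x y - evs V g x y + evs V h x y * evs V g x y * evs V g x y)%ps.
Proof.
  unfold frameA, frameB, frameC.
  rewrite !evs_add, !evs_scal, !evs_mul, evs_sone, pconst_neg1, pconst_neg2.
  repeat split; ring.
Qed.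

Lemma evs_D_frame V X g h x y :
  let g' := evs V (Ds X g) x y in let h' := evs V (Ds X h) x y in
  evs V (Ds X (frameB g h)) x y =
    (h' + g' - (h' * evs V g x y * evs V g x y
                + 2 * evs V h x y * evs V g x y * g'))%ps /\
  evs V (Ds X (frameC g h)) x y =
    (h' - g' + (h' * evs V g x y * evs V g x y
                + 2 * evs V h x y * evs V g x y * g'))%ps.
Proof.
  intros g' h'; unfold frameB, frameC.
  rewrite !evs_D_add, !evs_D_scal, !evs_D_mul, !evs_mul, pconst_neg1.
  fold g' h'; split; ring.
Qed.

Lemma ric_sum_diff V x y :
  (evs V ricP x y + evs V ricR x y = - ('I * 's * pconst (ev V (Atm Sh) x y)))%ps /\
  (evs V ricP x y - evs V ricR x y = - (2 * pconst (ev V uz x y)))%ps /\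
  evs V ricL x y = ('I * 's * pconst (ev V (Atm Ch) x y))%ps.
Proof.
  repeat split.
  - transitivity ('s * (- ('I * pconst (ev V (Atm Sh) x y))))%ps; [|ring].
    apply eq_shift; [|intros n; rewrite <- pconst_mul];
      unfold padd, popp, evs; [|destruct n]; simpl; field.
  - rewrite <- pconst_add, <- pconst_mul, <- pconst_opp.
    extensionality n; unfold padd, popp, evs; destruct n as [|[|n]]; simpl; field.
  - transitivity ('s * ('I * pconst (ev V (Atm Ch) x y)))%ps; [|ring].
    apply eq_shift; [reflexivity|intros n; rewrite <- pconst_mul].
    unfold evs; destruct n; reflexivity.
Qed.

Lemma D_ric V x y :
  let dw := pconst (ev V (D_y uz) x y) in
  let dq := pconst (V 0%nat 0%nat 1%nat x y) in
  let ch := pconst (ev V (Atm Ch) x y) in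
  let sh := pconst (ev V (Atm Sh) x y) in
  evs V (Ds shift_y ricP) x y = (- dw - 'I * 's * ch * dq)%ps /\
  evs V (Ds shift_y ricR) x y = (dw - 'I * 's * ch * dq)%ps /\
  (pconst (/ RtoC 2) * evs V (Ds shift_y ricL) x y = 'I * 's * sh * dq)%ps.
Proof.
  intros dw dq ch sh; repeat split.
  - transitivity (- dw + 's * - ('I * ch * dq))%ps; [|ring].
    unfold ch, dq, dw; rewrite <- !pconst_mul, <- !pconst_opp.
    apply split_order_0; [unfold evs, Ds; simpl; field|].
    intros [|n]; unfold evs, Ds; simpl; field.
  - transitivity (dw + 's * - ('I * ch * dq))%ps; [|ring].
    unfold ch, dq, dw; rewrite <- !pconst_mul, <- !pconst_opp.
    apply split_order_0; [unfold evs, Ds; simpl; field|].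
    intros [|n]; unfold evs, Ds; simpl; field.
  - transitivity ('s * ('I * sh * dq))%ps; [|ring].
    unfold sh, dq; rewrite <- !pconst_mul.
    apply eq_shift; intros; rewrite pmul_const_l; unfold evs, Ds.
    + simpl; field.
    + destruct n as [|n]; simpl; field.
Qed.

(** [s h' = s P - (i + s L + 2 s P gamma) h], the adjoint of the linearised Riccati
equation with source [beta_12]. *)
Definition adjoint (g h : dseries) : Prop :=
  riccati (- Ci) (fun _ => Con 0)
    (sscal (-1) (sadd ricL (sscal 2 (smul ricP g)))) ricP h.

Section Frame.

Variables g h : dseries.
Hypothesis Hg : riccati Ci ricP ricL ricR g.
Hypothesis Hh : adjoint g h.

Lemma adjoint_evs V x y :
  ('s * evs V (Ds shift_x h) x y =
   - ('I * evs V h x y)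
   + 's * (evs V ricP x y
           - (evs V ricL x y + 2 * evs V ricP x y * evs V g x y) * evs V h x y))%ps.
Proof.
  rewrite (riccati_evs _ _ _ _ _ opp_Ci_neq_0 Hh).
  assert (Z : evs V (fun _ => Con 0) x y = pconst 0)
    by (extensionality n; now destruct n).
  rewrite Z, evs_scal, evs_add, evs_scal, evs_mul, pconst_neg1, pconst_opp.
  replace (RtoC 2) with (1 + 1)%C by ring; rewrite pconst_add; ring.
Qed.

(** The constraint holds identically in [g] and [h]; the Lax equations follow from
the two Riccati equations. *)
Lemma frame_lax V x y :
  let A := evs V (frameA g h) x y in
  let B := evs V (frameB g h) x y in
  let C := evs V (frameC g h) x y in
  let K := ('I + 'I * 's * 's * pconst (ev V (Atm Ch) x y))%ps in
  ('s * evs V (Ds shift_x (frameB g h)) x y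
   = - ('I * 's * 's * pconst (ev V (Atm Sh) x y) * A) - K * C)%ps /\
  ('s * evs V (Ds shift_x (frameC g h)) x y
   = - (2 * 's * pconst (ev V uz x y) * A) - K * B)%ps /\
  (A * A + B * B - C * C = 1)%ps.
Proof.
  intros A B C K; unfold A, B, C.
  destruct (evs_frame V g h x y) as (-> & -> & ->).
  destruct (evs_D_frame V shift_x g h x y) as (-> & ->).
  destruct (ric_sum_diff V x y) as (ES & ED & EL).
  assert (Eg := riccati_evs _ _ _ _ _ Ci_neq_0 Hg V x y).
  assert (Eh := adjoint_evs V x y).
  assert (EK : (K = 'I + 's * evs V ricL x y)%ps) by (rewrite EL; unfold K; ring).
  rewrite EK; clear EK EL K.
  set (P := evs V ricP x y) in *; set (R := evs V ricR x y) in *.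
  set (G := evs V g x y) in *; set (H := evs V h x y) in *.
  set (dG := evs V (Ds shift_x g) x y) in *.
  set (dH := evs V (Ds shift_x h) x y) in *.
  split; [|split].
  - transitivity ('s * dH + 's * dG - ('s * dH * G * G + 2 * H * G * ('s * dG)))%ps;
      [ring|].
    rewrite Eg, Eh.
    transitivity ('s * (P + R) * (1 - 2 * H * G)
                  - ('I + 's * evs V ricL x y) * (H - G + H * G * G))%ps; [ring|].
    rewrite ES; ring.
  - transitivity ('s * dH - 's * dG + ('s * dH * G * G + 2 * H * G * ('s * dG)))%ps;
      [ring|].
    rewrite Eg, Eh.
    transitivity ('s * (P - R) * (1 - 2 * H * G)
                  - ('I + 's * evs V ricL x y) * (H + G - H * G * G))%ps; [ring|].
    rewrite ED; ring.
  - ring.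
Qed.

Lemma frame_is_lax_frame w V y : jets w V -> Rabs y < w ->
  lax_frame (fun x => ev V uz x y) (fun x => ev V (Atm Ch) x y)
    (fun x => ev V (Atm Sh) x y)
    (fun x => evs V (frameA g h) x y) (fun x => evs V (frameB g h) x y)
    (fun x => evs V (frameC g h) x y).
Proof.
  intros HV Hy.
  exists (fun x => evs V (Ds shift_x (frameB g h)) x y).
  exists (fun x => evs V (Ds shift_x (frameC g h)) x y).
  split; [|split; [|split; [|split; [|split]]]]; intros x.
  - intros n; now apply (ev_dx w).
  - intros n; now apply (ev_dx w).
  - apply frame_lax.
  - apply frame_lax.
  - apply frame_lax.
  - destruct (evs_frame V g h x y) as (-> & _).
    assert (G0 : evs V g x y O = 0) by (unfold evs; now rewrite (proj1 Hg)).
    unfold padd, popp, pmul; simpl; rewrite G0; ring.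
Qed.

(** [P dG] in the variation of [b_11] is removed by the total derivative of
[h dG], because [h] solves the adjoint equation.  What remains is the trace of
[delta beta . Q]. *)
Lemma first_variation V x y :
  (evs V (Ds shift_y (diag11 g)) x y =
   's * (evs V (Ds shift_x (smul h (Ds shift_y g))) x y
         - pconst (ev V (D_y uz) x y) * evs V (frameB g h) x y
         + 'I * 's * pconst (V 0%nat 0%nat 1%nat x y)
           * (pconst (ev V (Atm Sh) x y) * evs V (frameA g h) x y
              + pconst (ev V (Atm Ch) x y) * evs V (frameC g h) x y)))%ps.
Proof.
  assert (E : evs V (Ds shift_y (diag11 g)) x y =
     ('s * evs V (Ds shift_y (sadd (sscal (/ RtoC 2) ricL) (smul ricP g))) x y)%ps).
  { apply eq_shift; reflexivity. }
  rewrite E, evs_D_add, evs_D_scal, !evs_D_mul.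
  destruct (evs_frame V g h x y) as (-> & -> & ->).
  assert (Com : evs V (Ds shift_x (Ds shift_y g)) x y
                = evs V (Ds shift_y (Ds shift_x g)) x y).
  { extensionality n; apply D_commute; reflexivity. }
  rewrite Com; clear E Com.
  assert (Eg := riccati_evs_D _ _ _ _ _ Ci_neq_0 Hg V shift_y x y).
  assert (Eh := adjoint_evs V x y).
  destruct (D_ric V x y) as (EP & ER & EL); cbv zeta in EP, ER, EL.
  assert (EL2 : evs V (Ds shift_y ricL) x y =
    (2 * (pconst (/ RtoC 2) * evs V (Ds shift_y ricL) x y))%ps).
  { transitivity (pconst (/ RtoC 2) * 2 * evs V (Ds shift_y ricL) x y)%ps; [|ring].
    rewrite half_twice; ring. }
  rewrite EL; rewrite EL in EL2; rewrite EL2, EP, ER in Eg; rewrite EP; clear EL EL2 EP ER.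
  set (X := evs V (Ds shift_y (Ds shift_x g)) x y) in *.
  set (P := evs V ricP x y) in *; set (L := evs V ricL x y) in *.
  set (G := evs V g x y) in *; set (H := evs V h x y) in *.
  set (dG := evs V (Ds shift_y g) x y) in *.
  set (dH := evs V (Ds shift_x h) x y) in *.
  match goal with |- _ = ('s * (_ - ?dw * ?B + ?T))%ps =>
    transitivity ('s * dH * dG + H * ('s * X) + 's * (T - dw * B))%ps end; [|ring].
  rewrite Eg, Eh; ring.
Qed.

End Frame.
(** * Differential polynomials annihilated by the z-derivative *)

(** The derivative of [deval _ P] at [v] in the direction [w]. *)
Fixpoint dlin (v w : nat -> C) (P : dpoly) : C :=
  match P with
  | Cst _ => 0
  | Jet k => w k
  | Add P Q => (dlin v w P + dlin v w Q)%C
  | Mul P Q => (dlin v w P * deval v Q + deval v P * dlin v w Q)%C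
  end.

Lemma deval_Dz v P : deval v (Dz P) = dlin v (fun k => v (S k)) P.
Proof. induction P as [a|k|P IHP Q IHQ|P IHP Q IHQ]; simpl; congruence. Qed.

Lemma dlin_add v w w' P :
  dlin v (fun k => (w k + w' k)%C) P = (dlin v w P + dlin v w' P)%C.
Proof.
  induction P as [a|k|P IHP Q IHQ|P IHP Q IHQ]; simpl;
    rewrite ?IHP, ?IHQ; ring.
Qed.

Lemma deval_cder v w P t :
  cder (fun t => deval (fun k => v k + t * w k)%C P) t
       (dlin (fun k => v k + t * w k)%C w P).
Proof.
  induction P as [a|k|P IHP Q IHQ|P IHP Q IHQ]; simpl.
  - apply cder_const.
  - apply (cder_eq _ _ (0 + (1 * w k + t * 0))%C); [ring|].
    apply cder_plus; [apply cder_const|].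
    apply (cder_mult (fun t => RtoC t) (fun _ => w k)); [|apply cder_const].
    apply cder_real, @is_derive_id.
  - now apply cder_plus.
  - now apply (cder_mult (fun t => deval (fun k => v k + t * w k)%C P)
                         (fun t => deval (fun k => v k + t * w k)%C Q)).
Qed.

Definition depends_below (N : nat) (P : dpoly) : Prop :=
  forall v v', (forall k, (k < N)%nat -> v k = v' k) -> deval v P = deval v' P.

Lemma depends_below_exists P : exists N, depends_below N P.
Proof.
  induction P as [a|k|P [N IHP] Q [M IHQ]|P [N IHP] Q [M IHQ]].
  - exists O; intros v v' _; reflexivity.
  - exists (S k); intros v v' H; apply H; lia.
  - exists (N + M)%nat; intros v v' H; simpl.
    rewrite (IHP v v'), (IHQ v v'); trivial; intros k Hk; apply H; lia.
  - exists (N + M)%nat; intros v v' H; simpl.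
    rewrite (IHP v v'), (IHQ v v'); trivial; intros k Hk; apply H; lia.
Qed.

Lemma dlin_depends N P v v' w : depends_below N P ->
  (forall k, (k < N)%nat -> v k = v' k) -> dlin v w P = dlin v' w P.
Proof.
  intros HP H.
  assert (E : forall v, dlin (fun k => v k + 0 * w k)%C w P = dlin v w P).
  { intros u; f_equal; extensionality k; ring. }
  rewrite <- (E v), <- (E v').
  eapply cder_unique; [apply (deval_cder v w P 0)|].
  apply (cder_ext (fun t => deval (fun k => v' k + t * w k)%C P));
    [|apply deval_cder].
  intros t; apply HP; intros k Hk; now rewrite H.
Qed.

Lemma cder_zero_const f : (forall t, cder f t 0) -> f 0 = f 1.
Proof.
  intros H; rewrite (surjective_pairing (f 0)), (surjective_pairing (f 1)).
  f_equal.
  - apply (eq_is_derive (fun t => Re (f t)) 0 1); [intros t _; apply H | lra].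
  - apply (eq_is_derive (fun t => Im (f t)) 0 1); [intros t _; apply H | lra].
Qed.

(** If [v_N] is the highest jet in [P], then [v_(N+1)] occurs in [Dz P] only in the
term [dP/dv_N . v_(N+1)].  Varying [v_(N+1)] shows that [dP/dv_N] vanishes, so
[P] does not depend on [v_N]; descend on [N]. *)
Lemma Dz_zero_const P : (forall v, deval v (Dz P) = 0) ->
  forall v v', deval v P = deval v' P.
Proof.
  intros H; destruct (depends_below_exists P) as [N HN].
  induction N as [|N IH].
  { intros v v'; apply HN; intros k Hk; lia. }
  apply IH; intros v v' Hv.
  set (w := fun k => if Nat.eqb k N then (v' N - v N)%C else RtoC 0).
  assert (Hw : forall u, dlin u w P = 0).
  { intros u.
    set (u' := fun k => (u k + if Nat.eqb k (S N) then v' N - v N else 0)%C).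
    assert (E : dlin u' (fun k => u' (S k)) P = 0) by (rewrite <- deval_Dz; apply H).
    rewrite (dlin_depends (S N) P u' u) in E;
      [|exact HN | intros k Hk; unfold u'; destruct (Nat.eqb_spec k (S N)); [lia|ring]].
    change (dlin u (fun k => (u (S k) + w k)%C) P = 0) in E.
    rewrite dlin_add, <- deval_Dz, H in E; rewrite <- E; ring. }
  transitivity (deval (fun k => v k + 1 * w k)%C P).
  - rewrite <- (cder_zero_const (fun t => deval (fun k => v k + t * w k)%C P)).
    + f_equal; extensionality k; ring.
    + intros t; rewrite <- (Hw (fun k => v k + t * w k)%C); apply deval_cder.
  - apply HN; intros k Hk; unfold w; destruct (Nat.eqb_spec k N) as [->|Hne].
    + ring.
    + rewrite Hv by lia; ring.
Qed.

Lemma deval_Dz_0 P : deval (fun _ => RtoC 0) (Dz P) = 0.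
Proof.
  induction P as [a|k|P IHP Q IHQ|P IHP Q IHQ]; simpl;
    rewrite ?IHP, ?IHQ; ring.
Qed.

(** * The generating series of the Pinkall-Sterling iteration *)

(** The generating series [B = 2 i sum (-1)^n omega_n s^(2n+1)] and the components
[C], [A] which the Lax equation in the direction [z] attaches to it. *)
Definition hatB (omega : nat -> dpoly) (n : nat) : dpoly :=
  if Nat.odd n then Mul (Cst (2 * Ci * (-1) ^ Nat.div2 n)) (omega (Nat.div2 n))
  else Cst 0.

Definition hatC (omega : nat -> dpoly) (n : nat) : dpoly :=
  match n with
  | O => Cst 0
  | S m => Mul (Cst Ci) (Dz (hatB omega m))
  end.

Definition hatA (omega phi : nat -> dpoly) (n : nat) : dpoly :=
  match n with
  | O => Cst 1
  | S m => if Nat.odd m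
           then Mul (Cst (2 * (-1) ^ Nat.div2 m))
                    (Add (Dz (omega (Nat.div2 m)))
                         (Mul (Cst (-1)) (phi (Nat.div2 m))))
           else Cst 0
  end.

Lemma parity_cases n : exists k,
  (n = 2 * k /\ Nat.odd n = false \/ n = 2 * k + 1 /\ Nat.odd n = true)%nat
  /\ Nat.div2 n = k.
Proof.
  exists (Nat.div2 n).
  assert (H := Nat.div2_odd n); destruct (Nat.odd n); simpl in H; split; try lia.
Qed.

Lemma Ci_sqr : (Ci * Ci)%C = (-1)%C.
Proof. apply injective_projections; simpl; ring. Qed.

Section Iteration.

Variables omega phi : nat -> dpoly.
Hypothesis HPS : pinkall_sterling omega phi.

(** This is the equation that defines [phi_n]. *)
Lemma hatA_Dz n v :
  deval v (Dz (hatA omega phi n)) = (- (2 * v O * deval v (hatC omega n)))%C.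
Proof.
  destruct HPS as [_ H]; destruct n as [|n]; simpl; [ring|].
  unfold hatB; destruct (parity_cases n) as (k & Hk & ->).
  destruct Hk as [[_ ->]|[_ ->]]; simpl; [ring|].
  destruct (H k) as (_ & E & _); specialize (E v); simpl in E; rewrite E.
  set (d := deval v (Dz (omega k))).
  transitivity (2 * v O * (2 * (-1) ^ k * d) + 0)%C; [ring|].
  transitivity (- (2 * v O * ((Ci * Ci) * (2 * (-1) ^ k * d))))%C; [|ring].
  rewrite Ci_sqr; ring.
Qed.

(** This is the equation that defines [omega_(n+1)]. *)
Lemma hatB_S n v :
  deval v (hatB omega (S n)) =
  (Ci * (deval v (Dz (hatC omega n)) + 2 * v O * deval v (hatA omega phi n)))%C.
Proof.
  destruct HPS as [H0 H]; destruct n as [|n].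
  - unfold hatB; simpl; rewrite (H0 v); simpl; ring.
  - unfold hatB; destruct (parity_cases n) as (k & Hk & Ek); simpl hatC; simpl hatA.
    unfold hatB.
    destruct Hk as [[En Ho]|[En Ho]]; rewrite Ek, Ho.
    + replace (Nat.odd (S (S n))) with (Nat.odd n) by reflexivity.
      rewrite Ho; simpl; ring.
    + replace (Nat.odd (S (S n))) with (Nat.odd n) by reflexivity.
      replace (Nat.div2 (S (S n))) with (S k) by now rewrite <- Ek.
      rewrite Ho; destruct (H k) as (_ & E & E'); specialize (E v); specialize (E' v).
      simpl in *; rewrite E', E; simpl.
      set (d := deval v (Dz (omega k))); set (dd := deval v (Dz (Dz (omega k)))).
      transitivity (Ci * ((-1) * (2 * (-1) ^ k * dd)
        + 2 * v O * (2 * (-1) ^ k * (d + (-1) * deval v (phi k)))))%C; [ring|].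
      rewrite <- Ci_sqr; ring.
Qed.

Lemma omega_at_0 k : deval (fun _ => RtoC 0) (omega k) = 0.
Proof.
  destruct HPS as [H0 H]; destruct k as [|k]; [apply H0|].
  destruct (H k) as (_ & _ & E); rewrite E; simpl; rewrite deval_Dz_0; ring.
Qed.

Lemma hat_at_0 :
  (fun n => deval (fun _ => RtoC 0) (hatA omega phi n)) = pconst 1 /\
  (fun n => deval (fun _ => RtoC 0) (hatB omega n)) = pconst 0 /\
  (fun n => deval (fun _ => RtoC 0) (hatC omega n)) = pconst 0.
Proof.
  repeat split; extensionality n.
  - destruct n as [|n]; simpl; [reflexivity|].
    destruct (Nat.odd n); simpl; [|reflexivity].
    destruct HPS as [_ H]; destruct (H (Nat.div2 n)) as (E & _).
    unfold no_constant_term in E; rewrite E, deval_Dz_0; ring.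
  - unfold hatB; destruct (Nat.odd n); simpl; [rewrite omega_at_0|]; destruct n; simpl; ring.
  - destruct n as [|n]; simpl; [reflexivity|]; rewrite deval_Dz_0; ring.
Qed.

Definition dmul (f g : nat -> dpoly) : nat -> dpoly := fun n => cauchy Add Mul n f g.

Lemma deval_dmul v f g :
  (fun n => deval v (dmul f g n)) =
  (((fun n => deval v (f n)) : ps) * (fun n => deval v (g n)))%ps.
Proof.
  extensionality n; unfold dmul, pmul.
  now apply (cauchy_morph Add Mul Cplus Cmult (deval v)).
Qed.

Lemma deval_Dz_dmul v f g :
  (fun n => deval v (Dz (dmul f g n))) =
  (((fun n => deval v (Dz (f n))) : ps) * (fun n => deval v (g n))
   + ((fun n => deval v (f n)) : ps) * (fun n => deval v (Dz (g n))))%ps.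
Proof.
  extensionality n; unfold dmul.
  now apply (cauchy_leibniz Add Mul (deval v) (fun P => deval v (Dz P))).
Qed.

Definition hatA_at v : ps := fun n => deval v (hatA omega phi n).
Definition hatB_at v : ps := fun n => deval v (hatB omega n).
Definition hatC_at v : ps := fun n => deval v (hatC omega n).
Definition hatA'_at v : ps := fun n => deval v (Dz (hatA omega phi n)).
Definition hatB'_at v : ps := fun n => deval v (Dz (hatB omega n)).
Definition hatC'_at v : ps := fun n => deval v (Dz (hatC omega n)).

Lemma hat_equations v :
  hatA'_at v = (- (2 * pconst (v O) * hatC_at v))%ps /\
  hatB_at v = ('s * ('I * (hatC'_at v + 2 * pconst (v O) * hatA_at v)))%ps /\
  hatC_at v = ('s * ('I * hatB'_at v))%ps.
Proof.
  assert (E2 : (2 = pconst (RtoC 2))%ps) by (rewrite <- pconst_add; f_equal; ring).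
  rewrite E2, <- pconst_mul; repeat split.
  - extensionality n; unfold hatA'_at; rewrite hatA_Dz.
    unfold popp; rewrite pmul_const_l; reflexivity.
  - apply eq_shift; [reflexivity|]; intros n; unfold hatB_at; rewrite hatB_S.
    rewrite pmul_const_l; unfold padd; rewrite pmul_const_l; reflexivity.
  - apply eq_shift; [reflexivity|]; intros n; now rewrite pmul_const_l.
Qed.

(** The Lax equations make the left side a constant polynomial; its value at zero
is [1] because neither [phi_n] nor [omega_n] has a constant term. *)
Lemma hat_conserved v :
  (hatA_at v * hatA_at v + hatB_at v * hatB_at v - hatC_at v * hatC_at v = 1)%ps.
Proof.
  set (G := fun n => Add (dmul (hatA omega phi) (hatA omega phi) n)
    (Add (dmul (hatB omega) (hatB omega) n)
         (Mul (Cst (-1)) (dmul (hatC omega) (hatC omega) n)))).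
  assert (E : forall v, (fun n => deval v (G n)) =
    (hatA_at v * hatA_at v + (hatB_at v * hatB_at v
     + pconst (-1) * (hatC_at v * hatC_at v)))%ps).
  { intros u; unfold hatA_at, hatB_at, hatC_at; rewrite <- !deval_dmul.
    extensionality n; unfold padd; rewrite pmul_const_l; reflexivity. }
  assert (E' : forall v, (fun n => deval v (Dz (G n))) =
    ((hatA'_at v * hatA_at v + hatA_at v * hatA'_at v)
     + ((hatB'_at v * hatB_at v + hatB_at v * hatB'_at v)
     + pconst (-1) * (hatC'_at v * hatC_at v + hatC_at v * hatC'_at v)))%ps).
  { intros u; unfold hatA_at, hatB_at, hatC_at, hatA'_at, hatB'_at, hatC'_at.
    rewrite <- !deval_Dz_dmul.
    extensionality n; unfold padd; rewrite pmul_const_l; simpl; ring. }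
  assert (Z : forall n v, deval v (Dz (G n)) = 0).
  { intros n u; transitivity (pconst 0 n); [|now destruct n].
    apply (f_equal (fun f : ps => f n) (x := fun n => deval u (Dz (G n)))).
    rewrite E', pconst_neg1; destruct (hat_equations u) as (EA & EB & EC).
    rewrite EA.
    transitivity (2 * (- (2 * pconst (u O) * hatC_at u) * hatA_at u
      + hatB_at u * hatB'_at u - hatC_at u * hatC'_at u))%ps; [ring|].
    rewrite EB, EC; ring. }
  transitivity (fun n => deval v (G n)); [rewrite E, pconst_neg1; ring|].
  transitivity (fun n => deval (fun _ => RtoC 0) (G n)).
  { extensionality n; now apply Dz_zero_const. }
  rewrite E; unfold hatA_at, hatB_at, hatC_at.
  destruct hat_at_0 as (-> & -> & ->); ring.
Qed.

End Iteration.
(** * Solutions of the sinh-Gordon equation *)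

Lemma strip_locally w y : Rabs y < w -> locally y (fun t : R => Rabs t < w).
Proof.
  intros Hy.
  assert (Hp : 0 < w - Rabs y) by lra.
  assert (T : forall t : R, Rabs t <= Rabs (t - y) + Rabs y).
  { intros t; replace t with (t - y + y) at 1 by ring; apply Rabs_triang. }
  exists (mkposreal _ Hp); intros t Ht; specialize (T t).
  change (Rabs (t - y) < w - Rabs y) in Ht; lra.
Qed.

(** An identity that holds on an open strip can be differentiated. *)
Lemma ev_D_ext w V e f : jets w V ->
  (forall x y, Rabs y < w -> ev V e x y = ev V f x y) ->
  forall x y, Rabs y < w ->
  ev V (D_x e) x y = ev V (D_x f) x y /\ ev V (D_y e) x y = ev V (D_y f) x y.
Proof.
  intros HV H x y Hy; split.
  - eapply cder_unique; [now apply (ev_dx w)|].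
    apply (cder_ext (fun t => ev V f t y)); [intros t; now rewrite H | now apply (ev_dx w)].
  - eapply cder_unique; [now apply (ev_dy w)|].
    destruct (ev_dy w V f x y HV Hy) as [H1 H2].
    split; [revert H1 | revert H2]; apply is_derive_ext_loc;
      generalize (strip_locally w y Hy); apply filter_imp; intros t Ht; now rewrite H.
Qed.

Lemma ev_D_z_ext w V e f : jets w V ->
  (forall x y, Rabs y < w -> ev V e x y = ev V f x y) ->
  forall x y, Rabs y < w -> ev V (D_z e) x y = ev V (D_z f) x y.
Proof.
  intros HV H x y Hy; rewrite !D_z_xy.
  now destruct (ev_D_ext w V e f HV H x y Hy) as [-> ->].
Qed.

Lemma ev_D_zb_ext w V e f : jets w V ->
  (forall x y, Rabs y < w -> ev V e x y = ev V f x y) ->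
  forall x y, Rabs y < w -> ev V (D_zb e) x y = ev V (D_zb f) x y.
Proof.
  intros HV H x y Hy; rewrite !D_zb_xy.
  now destruct (ev_D_ext w V e f HV H x y Hy) as [-> ->].
Qed.

Lemma evs_D_zb_ext w V f g : jets w V ->
  (forall x y, Rabs y < w -> evs V f x y = evs V g x y) ->
  forall x y, Rabs y < w -> evs V (Ds shift_zb f) x y = evs V (Ds shift_zb g) x y.
Proof.
  intros HV H x y Hy; extensionality n; apply (ev_D_zb_ext w); trivial.
  intros s t Hs; exact (f_equal (fun F : ps => F n) (H s t Hs)).
Qed.

Lemma evs_D_x V f x y :
  evs V (Ds shift_x f) x y
  = (evs V (Ds shift_z f) x y + evs V (Ds shift_zb f) x y)%ps.
Proof.
  extensionality n; unfold padd, evs, Ds; rewrite D_z_xy, D_zb_xy; field.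
Qed.

Lemma ev_D_y V e x y : ev V (D_y e) x y = (Ci * (ev V (D_z e) x y - ev V (D_zb e) x y))%C.
Proof.
  rewrite D_z_xy, D_zb_xy.
  transitivity (- (Ci * Ci) * ev V (D_y e) x y)%C; [rewrite Ci_sqr; ring | field].
Qed.

Definition sshift (f : dseries) : dseries :=
  fun n => match n with O => Con 0 | S m => f m end.
Definition stimes (e : dexpr) (f : dseries) : dseries := fun n => Times e (f n).

Lemma evs_shift V f x y : evs V (sshift f) x y = ('s * evs V f x y)%ps.
Proof. now apply eq_shift. Qed.

Lemma evs_D_shift V X f x y :
  evs V (Ds X (sshift f)) x y = ('s * evs V (Ds X f) x y)%ps.
Proof. now apply eq_shift. Qed.

Lemma evs_times V e f x y :
  evs V (stimes e f) x y = (pconst (ev V e x y) * evs V f x y)%ps.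
Proof. extensionality n; now rewrite pmul_const_l. Qed.

Lemma evs_D_times V X e f x y :
  evs V (Ds X (stimes e f)) x y =
  (pconst (ev V (D X e) x y) * evs V f x y
   + pconst (ev V e x y) * evs V (Ds X f) x y)%ps.
Proof. extensionality n; unfold padd; now rewrite !pmul_const_l. Qed.

Fixpoint zjet (k : nat) : dexpr :=
  match k with O => uz | S j => D_z (zjet j) end.

Fixpoint to_dexpr (P : dpoly) : dexpr :=
  match P with
  | Cst a => Con a
  | Jet k => zjet k
  | Add P Q => Plus (to_dexpr P) (to_dexpr Q)
  | Mul P Q => Times (to_dexpr P) (to_dexpr Q)
  end.

Lemma to_dexpr_Dz P : to_dexpr (Dz P) = D_z (to_dexpr P).
Proof. induction P as [a|k|P IHP Q IHQ|P IHP Q IHQ]; simpl; congruence. Qed.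

Lemma ev_to_dexpr V P x y : ev V (to_dexpr P) x y = deval (fun k => ev V (zjet k) x y) P.
Proof. induction P as [a|k|P IHP Q IHQ|P IHP Q IHQ]; simpl; congruence. Qed.

(** The second datum is the [y]-derivative of the first. *)
Definition sinh_gordon_env (w : R) (V : env) : Prop :=
  jets w V /\
  (forall j k x y, V 1%nat j k x y = V 0%nat j (S k) x y) /\
  (forall x y, Rabs y < w ->
     V 0%nat 2%nat 0%nat x y + V 0%nat 0%nat 2%nat x y
     + 2 * sinh (2 * V 0%nat 0%nat 0%nat x y) = 0).

Section SinhGordon.

Variables omega phi : nat -> dpoly.
Hypothesis HPS : pinkall_sterling omega phi.
Variables (w : R) (V : env).
Hypothesis HV : sinh_gordon_env w V.

Definition sA : dseries := fun n => to_dexpr (hatA omega phi n).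
Definition sB : dseries := fun n => to_dexpr (hatB omega n).
Definition sC : dseries := fun n => to_dexpr (hatC omega n).

Lemma z_equations x y :
  let A := evs V sA x y in let B := evs V sB x y in let C := evs V sC x y in
  let u := pconst (ev V uz x y) in
  evs V (Ds shift_z sA) x y = (- (2 * u * C))%ps /\
  B = ('s * ('I * (evs V (Ds shift_z sC) x y + 2 * u * A)))%ps /\
  C = ('s * ('I * evs V (Ds shift_z sB) x y))%ps /\
  (A * A + B * B - C * C = 1)%ps.
Proof.
  intros A B C u.
  set (v := fun k => ev V (zjet k) x y).
  assert (EA : A = hatA_at omega phi v) by (extensionality n; apply ev_to_dexpr).
  assert (EB : B = hatB_at omega v) by (extensionality n; apply ev_to_dexpr).
  assert (EC : C = hatC_at omega v) by (extensionality n; apply ev_to_dexpr).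
  assert (EA' : evs V (Ds shift_z sA) x y = hatA'_at omega phi v).
  { extensionality n; unfold evs, Ds, sA; rewrite <- to_dexpr_Dz; apply ev_to_dexpr. }
  assert (EB' : evs V (Ds shift_z sB) x y = hatB'_at omega v).
  { extensionality n; unfold evs, Ds, sB; rewrite <- to_dexpr_Dz; apply ev_to_dexpr. }
  assert (EC' : evs V (Ds shift_z sC) x y = hatC'_at omega v).
  { extensionality n; unfold evs, Ds, sC; rewrite <- to_dexpr_Dz; apply ev_to_dexpr. }
  rewrite EA', EB', EC', EA, EB, EC.
  destruct (hat_equations omega phi HPS v) as (E1 & E2 & E3).
  split; [exact E1|split; [exact E2|split; [exact E3|]]].
  exact (hat_conserved omega phi HPS v).
Qed.

Lemma commute_z_zb e x y : ev V (D_z (D_zb e)) x y = ev V (D_zb (D_z e)) x y.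
Proof. apply D_commute; intros; simpl; ring. Qed.

Lemma ev_shift_z x y : ev V (shift_z 0 0 0) x y = ev V uz x y.
Proof. destruct HV as (_ & E & _); simpl; now rewrite E. Qed.

(** The sinh-Gordon equation, in the form [4 u_(z zb) + 2 sinh 2u = 0]. *)
Lemma ev_zb_uz x y : Rabs y < w ->
  ev V (D_zb uz) x y = (- / 2 * ev V (Atm Sh) x y)%C.
Proof.
  intros Hy; destruct HV as (_ & E & PDE); specialize (PDE x y Hy); simpl.
  rewrite !E.
  transitivity (/ 2 * / 2 * (V 0%nat 2%nat 0%nat x y + - (Ci * Ci) * V 0%nat 0%nat 2%nat x y))%C;
    [ring|]; rewrite Ci_sqr.
  transitivity (/ 2 * / 2 * (V 0%nat 2%nat 0%nat x y + V 0%nat 0%nat 2%nat x y)%R)%C;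
    [rewrite RtoC_plus; ring|].
  replace (V 0%nat 2%nat 0%nat x y + V 0%nat 0%nat 2%nat x y)
    with (- (2 * sinh (2 * V 0%nat 0%nat 0%nat x y))) by lra.
  rewrite RtoC_opp, RtoC_mult; field.
Qed.

(** The defects of the Lax equation in the direction [zb]. *)
Definition resA : dseries :=
  sadd (Ds shift_zb sA) (sscal (- Ci) (sshift (stimes (Atm Sh) sB))).
Definition resB : dseries :=
  sadd (Ds shift_zb sB)
       (sscal Ci (sshift (sadd (stimes (Atm Sh) sA) (stimes (Atm Ch) sC)))).
Definition resC : dseries :=
  sadd (Ds shift_zb sC) (sscal Ci (sshift (stimes (Atm Ch) sB))).

Lemma evs_res x y :
  let A := evs V sA x y in let B := evs V sB x y in let C := evs V sC x y in
  let ch := pconst (ev V (Atm Ch) x y) in let sh := pconst (ev V (Atm Sh) x y) in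
  evs V resA x y = (evs V (Ds shift_zb sA) x y - 'I * 's * sh * B)%ps /\
  evs V resB x y = (evs V (Ds shift_zb sB) x y + 'I * 's * (sh * A + ch * C))%ps /\
  evs V resC x y = (evs V (Ds shift_zb sC) x y + 'I * 's * ch * B)%ps.
Proof.
  intros A B C ch sh; unfold resA, resB, resC.
  rewrite !evs_add, !evs_scal, !evs_shift, !evs_add, !evs_times, pconst_opp.
  fold A B C ch sh; repeat split; ring.
Qed.

Lemma evs_commute_z_zb f x y :
  evs V (Ds shift_z (Ds shift_zb f)) x y = evs V (Ds shift_zb (Ds shift_z f)) x y.
Proof. extensionality n; apply commute_z_zb. Qed.

Lemma zb_equations x y : Rabs y < w ->
  let A := evs V sA x y in
  let B := evs V sB x y in let C := evs V sC x y in
  let zA := evs V (Ds shift_zb sA) x y in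
  let zB := evs V (Ds shift_zb sB) x y in
  let zC := evs V (Ds shift_zb sC) x y in
  let u := pconst (ev V uz x y) in let sh := pconst (ev V (Atm Sh) x y) in
  zB = ('s * ('I * (evs V (Ds shift_zb (Ds shift_z sC)) x y - sh * A + 2 * u * zA)))%ps /\
  zC = ('s * ('I * evs V (Ds shift_zb (Ds shift_z sB)) x y))%ps /\
  (A * zA + B * zB - C * zC = 0)%ps.
Proof.
  intros Hy A B C zA zB zC u sh; destruct HV as (HJ & _).
  assert (E2 : (pconst (RtoC 2) = 2)%ps) by (rewrite <- pconst_add; f_equal; ring).
  split; [|split].
  - unfold zB; rewrite (evs_D_zb_ext w V sB
      (sshift (sscal Ci (sadd (Ds shift_z sC) (sscal 2 (stimes uz sA))))) HJ);
      [|intros x' y' _|exact Hy].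
    + rewrite evs_D_shift, evs_D_scal, evs_D_add, evs_D_scal, evs_D_times.
      rewrite ev_zb_uz, pconst_mul, pconst_opp, E2 by exact Hy; fold A u sh zA.
      transitivity ('s * ('I * (evs V (Ds shift_zb (Ds shift_z sC)) x y
        - (pconst (/ RtoC 2) * 2) * sh * A + 2 * u * zA)))%ps; [ring|].
      rewrite half_twice; ring.
    + rewrite evs_shift, evs_scal, evs_add, evs_scal, evs_times, E2.
      destruct (z_equations x' y') as (_ & E & _ & _); rewrite E at 1; ring.
  - unfold zC; rewrite (evs_D_zb_ext w V sC
      (sshift (sscal Ci (Ds shift_z sB))) HJ); [|intros x' y' _|exact Hy].
    + now rewrite evs_D_shift, evs_D_scal.
    + rewrite evs_shift, evs_scal; apply (z_equations x' y').
  - assert (E : evs V (Ds shift_zb (sadd (smul sA sA)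
        (sadd (smul sB sB) (sscal (-1) (smul sC sC))))) x y
      = evs V (Ds shift_zb sone) x y).
    { apply (evs_D_zb_ext w); trivial; intros x' y' _.
      rewrite !evs_add, evs_scal, !evs_mul, evs_sone, pconst_neg1.
      destruct (z_equations x' y') as (_ & _ & _ & E); etransitivity; [|exact E]; ring. }
    rewrite !evs_D_add, evs_D_scal, !evs_D_mul, evs_D_sone, pconst_neg1 in E.
    fold A B C zA zB zC in E.
    transitivity (pconst (/ RtoC 2) * 2 * (A * zA + B * zB - C * zC))%ps;
      [rewrite half_twice; ring|].
    transitivity (pconst (/ RtoC 2) * (zA * A + A * zA + (zB * B + B * zB
        + - (1) * (zC * C + C * zC))))%ps; [ring | rewrite E; ring].
Qed.

(** The defects satisfy the Lax equation in the direction [z]: this is the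
flatness of the connection. *)
Lemma res_recursion x y : Rabs y < w ->
  evs V resC x y = ('s * ('I * evs V (Ds shift_z resB) x y))%ps /\
  evs V resB x y = ('s * ('I * (evs V (Ds shift_z resC) x y
                     + 2 * pconst (ev V uz x y) * evs V resA x y)))%ps.
Proof.
  intros Hy.
  destruct (evs_res x y) as (RA & RB & RC); rewrite RA, RB, RC.
  unfold resB, resC.
  rewrite !evs_D_add, !evs_D_scal, !evs_D_shift, !evs_D_add, !evs_D_times,
    !evs_commute_z_zb.
  assert (Esh : pconst (ev V (D shift_z (Atm Sh)) x y)
    = (2 * pconst (ev V uz x y) * pconst (ev V (Atm Ch) x y))%ps).
  { rewrite <- pconst_add, <- !pconst_mul; f_equal.
    change (ev V (D shift_z (Atm Sh)) x y)
      with (2 * (ev V (Atm Ch) x y * ev V (shift_z 0 0 0) x y))%C.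
    rewrite ev_shift_z; ring. }
  assert (Ech : pconst (ev V (D shift_z (Atm Ch)) x y)
    = (2 * pconst (ev V uz x y) * pconst (ev V (Atm Sh) x y))%ps).
  { rewrite <- pconst_add, <- !pconst_mul; f_equal.
    change (ev V (D shift_z (Atm Ch)) x y)
      with (2 * (ev V (Atm Sh) x y * ev V (shift_z 0 0 0) x y))%C.
    rewrite ev_shift_z; ring. }
  rewrite Esh, Ech; clear Esh Ech RA RB RC.
  destruct (z_equations x y) as (Az & Bz & Cz & _).
  destruct (zb_equations x y Hy) as (Bb & Cb & _).
  cbv zeta in *; rewrite Az.
  set (A := evs V sA x y) in *; set (B := evs V sB x y) in *.
  set (C := evs V sC x y) in *.
  set (zA := evs V (Ds shift_zb sA) x y) in *.
  set (u := pconst (ev V uz x y)) in *.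
  set (ch := pconst (ev V (Atm Ch) x y)) in *.
  set (sh := pconst (ev V (Atm Sh) x y)) in *.
  set (Cz' := evs V (Ds shift_z sC) x y) in *.
  set (Bz' := evs V (Ds shift_z sB) x y) in *.
  split.
  - rewrite Cb.
    transitivity ('s * ('I * evs V (Ds shift_zb (Ds shift_z sB)) x y)
      + 'I * 's * ch * ('s * ('I * (Cz' + 2 * u * A))))%ps; [|ring].
    rewrite <- Bz; ring.
  - rewrite Bb.
    transitivity ('s * ('I * (evs V (Ds shift_zb (Ds shift_z sC)) x y
      + ch * ('s * ('I * Bz')) + 2 * u * zA)))%ps; [|ring].
    rewrite <- Cz; ring.
Qed.

(** By the recursion each coefficient of [resB], [resC] is a combination of lower
coefficients of the defects and of their [z]-derivatives, which vanish with
them on the open strip. *)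
Lemma zb_flow x y : Rabs y < w ->
  evs V resA x y = pconst 0 /\ evs V resB x y = pconst 0 /\ evs V resC x y = pconst 0.
Proof.
  intros Hy.
  set (T := {t : R * R | Rabs (snd t) < w}).
  set (at_ := fun (f : dseries) (t : T) => evs V f (fst (proj1_sig t)) (snd (proj1_sig t))).
  assert (Z : forall n (t : T), below n (at_ resA t) /\ below n (at_ resB t)
                                /\ below n (at_ resC t)).
  { apply (conserved_vanish (at_ sA) (at_ sB) (at_ sC) _ _ _ 1).
    - intros E; injection E; lra.
    - reflexivity.
    - reflexivity.
    - reflexivity.
    - intros [[s t] Ht]; unfold at_; simpl in *.
      destruct (evs_res s t) as (-> & -> & ->).
      destruct (zb_equations s t Ht) as (_ & _ & E).
      etransitivity; [|exact E]; ring.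
    - intros n Hn t.
      assert (DZ : forall f, (forall t, below n (at_ f t)) ->
                forall t, below n (at_ (Ds shift_z f) t)).
      { intros f Hf [[s' t'] Ht'] k Hk; unfold at_, evs, Ds; simpl in *.
        transitivity (ev V (D_z (Con 0)) s' t'); [|reflexivity].
        apply (ev_D_z_ext w); [apply HV | | exact Ht'].
        intros a b Hb; exact (Hf (exist _ (a, b) Hb) k Hk). }
      assert (HA : forall t, below n (at_ resA t)) by (intros t'; apply Hn).
      assert (HB : forall t, below n (at_ resB t)) by (intros t'; apply Hn).
      assert (HC : forall t, below n (at_ resC t)) by (intros t'; apply Hn).
      specialize (HA t); apply DZ with (t := t) in HB; apply DZ with (t := t) in HC.
      destruct t as [[s t] Ht]; unfold at_ in *; simpl in *.
      destruct (res_recursion s t Ht) as (-> & ->); split; apply below_s, below_mul.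
      + apply below_add; [exact HC | now apply below_mul].
      + exact HB. }
  repeat split; extensionality n;
    destruct (Z (S n) (exist _ (x, y) Hy)) as (ZA & ZB & ZC);
    [specialize (ZA n (Nat.lt_succ_diag_r n)) | specialize (ZB n (Nat.lt_succ_diag_r n))
     | specialize (ZC n (Nat.lt_succ_diag_r n))];
    (etransitivity; [eassumption | now destruct n]).
Qed.

Lemma solution_is_lax_frame : 0 < w ->
  lax_frame (fun x => ev V uz x 0) (fun x => ev V (Atm Ch) x 0)
    (fun x => ev V (Atm Sh) x 0)
    (fun x => evs V sA x 0) (fun x => evs V sB x 0) (fun x => evs V sC x 0).
Proof.
  intros Hw; assert (H0 : Rabs 0 < w) by now rewrite Rabs_R0.
  exists (fun x => evs V (Ds shift_x sB) x 0), (fun x => evs V (Ds shift_x sC) x 0).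
  assert (F : forall x,
    ('s * evs V (Ds shift_x sB) x 0 =
      - ('I * 's * 's * pconst (ev V (Atm Sh) x 0) * evs V sA x 0)
      - ('I + 'I * 's * 's * pconst (ev V (Atm Ch) x 0)) * evs V sC x 0)%ps /\
    ('s * evs V (Ds shift_x sC) x 0 =
      - (2 * 's * pconst (ev V uz x 0) * evs V sA x 0)
      - ('I + 'I * 's * 's * pconst (ev V (Atm Ch) x 0)) * evs V sB x 0)%ps).
  { intros x; rewrite !evs_D_x.
    destruct (z_equations x 0) as (_ & EB & EC & _).
    destruct (zb_flow x 0 H0) as (_ & ZB & ZC).
    destruct (evs_res x 0) as (_ & RB & RC).
    rewrite RB in ZB; rewrite RC in ZC; clear RB RC.
    cbv zeta in *; split.
    - transitivity ('s * evs V (Ds shift_z sB) x 0 + 'I * evs V sC x 0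
        - 'I * evs V sC x 0
        + 's * (evs V (Ds shift_zb sB) x 0 + 'I * 's *
           (pconst (ev V (Atm Sh) x 0) * evs V sA x 0
            + pconst (ev V (Atm Ch) x 0) * evs V sC x 0))
        - 's * ('I * 's *
           (pconst (ev V (Atm Sh) x 0) * evs V sA x 0
            + pconst (ev V (Atm Ch) x 0) * evs V sC x 0)))%ps; [ring|].
      rewrite ZB; rewrite EC at 1; ring [I_sqr].
    - transitivity ('s * evs V (Ds shift_z sC) x 0 + 'I * evs V sB x 0
        - 'I * evs V sB x 0
        + 's * (evs V (Ds shift_zb sC) x 0 + 'I * 's *
           pconst (ev V (Atm Ch) x 0) * evs V sB x 0)
        - 's * ('I * 's * pconst (ev V (Atm Ch) x 0) * evs V sB x 0))%ps; [ring|].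
      rewrite ZC; rewrite EB at 1; ring [I_sqr]. }
  split; [|split; [|split; [|split; [|split]]]]; intros x.
  - intros n; apply (ev_dx w); [apply HV | exact H0].
  - intros n; apply (ev_dx w); [apply HV | exact H0].
  - apply F.
  - apply F.
  - apply z_equations.
  - reflexivity.
Qed.

End SinhGordon.
(** * Jets of a function of two variables *)

Definition dX (f : R -> R -> R) (x y : R) : R := Derive (fun t => f t y) x.
Definition dY (f : R -> R -> R) (x y : R) : R := Derive (fun t => f x t) y.

Definition strip_smooth (w : R) (f : R -> R -> R) : Prop :=
  forall n x y, Rabs y < w -> ex_diff_n f n x y.

Lemma strip_smooth_dX w f : strip_smooth w f -> strip_smooth w (dX f).
Proof. intros H n x y Hy; apply (H (S n) x y Hy). Qed.

Lemma strip_smooth_dY w f : strip_smooth w f -> strip_smooth w (dY f).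
Proof. intros H n x y Hy; apply (H (S n) x y Hy). Qed.

Lemma strip_smooth_iter w f D j :
  (forall f, strip_smooth w f -> strip_smooth w (D f)) ->
  strip_smooth w f -> strip_smooth w (Nat.iter j D f).
Proof. intros HD Hf; induction j; simpl; auto. Qed.

Lemma strip_schwarz w f x y : strip_smooth w f -> Rabs y < w ->
  dY (dX f) x y = dX (dY f) x y.
Proof.
  intros Hf Hy; symmetry; apply Schwarz.
  - destruct (strip_locally w y Hy) as [d Hd]; exists d; intros s t Hs Ht.
    assert (Hw : Rabs t < w) by now apply Hd.
    destruct (Hf 2%nat s t Hw) as (_ & H1 & H2 & (_ & _ & H3 & _) & (_ & H4 & _)).
    repeat split; assumption.
  - destruct (Hf 2%nat x y Hy) as (_ & _ & _ & _ & (_ & _ & _ & (H & _) & _)).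
    exact H.
  - destruct (Hf 2%nat x y Hy) as (_ & _ & _ & (_ & _ & _ & _ & (H & _)) & _).
    exact H.
Qed.

(** The second datum being [u_y], the index [i] counts as one more
[y]-derivative. *)
Definition jets_of (u : R -> R -> R) : env := fun i j k x y =>
  Nat.iter j dX (Nat.iter (i + k) dY u) x y.

Lemma jets_of_jets w u : strip_smooth w u -> jets w (jets_of u).
Proof.
  intros Hu i j k x y Hy; unfold jets_of.
  set (g := Nat.iter (i + k) dY u).
  assert (Hg : strip_smooth w g)
    by (apply strip_smooth_iter; [apply strip_smooth_dY | exact Hu]).
  assert (Hj : forall j, strip_smooth w (Nat.iter j dX g))
    by (intros m; apply strip_smooth_iter; [apply strip_smooth_dX | exact Hg]).
  destruct (Hj j 1%nat x y Hy) as (_ & H1 & H2 & _); split.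
  - exact (Derive_correct _ _ H1).
  - replace (Nat.iter j dX (Nat.iter (i + S k) dY u) x y)
      with (dY (Nat.iter j dX g) x y); [exact (Derive_correct _ _ H2)|].
    rewrite Nat.add_succ_r; change (Nat.iter (S (i + k)) dY u) with (dY g).
    clear H1 H2; revert x; induction j as [|j IH]; intros x; [reflexivity|].
    change (dY (dX (Nat.iter j dX g)) x y = dX (Nat.iter j dX (dY g)) x y).
    rewrite (strip_schwarz w) by auto.
    unfold dX at 1 3; apply Derive_ext; exact IH.
Qed.

(** Valid without differentiability, by the definition of [Derive] as a limit. *)
Lemma Derive_periodic p f x :
  (forall t, f (t + p) = f t) -> Derive f (x + p) = Derive f x.
Proof.
  intros H; unfold Derive; f_equal; apply Lim_ext; intros h.
  replace (x + p + h) with (x + h + p) by ring; now rewrite !H.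
Qed.

Lemma jets_of_periodic w p u i j k x y :
  (forall x y, Rabs y < w -> u (x + p) y = u x y) -> Rabs y < w ->
  jets_of u i j k (x + p) y = jets_of u i j k x y.
Proof.
  intros Hu; unfold jets_of.
  assert (HY : forall m x y, Rabs y < w ->
                 Nat.iter m dY u (x + p) y = Nat.iter m dY u x y).
  { induction m as [|m IH]; intros s t Ht; [now apply Hu|].
    simpl; unfold dY at 1 3; apply Derive_ext_loc.
    generalize (strip_locally w t Ht); apply filter_imp; intros; now apply IH. }
  specialize (HY (i + k)%nat); revert x y.
  induction j as [|j IH]; intros s t Ht; [now apply HY|].
  simpl; unfold dX at 1 3; apply (Derive_periodic p (fun t' => Nat.iter j dX _ t' t)).
  intros s'; now apply IH.
Qed.

Lemma ev_periodic V p e x y :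
  (forall i j k x, V i j k (x + p) y = V i j k x y) ->
  ev V e (x + p) y = ev V e x y.
Proof.
  intros H; induction e as [a|[i j k| |]|e IHe f IHf|e IHe f IHf]; simpl;
    rewrite ?H; congruence.
Qed.

(** * Differential polynomials on a solution *)

Lemma d_x_ev w V f e x y : jets w V ->
  (forall x y, Rabs y < w -> f x y = ev V e x y) -> Rabs y < w ->
  d_x f x y = ev V (D_x e) x y.
Proof.
  intros HV Hf Hy; destruct (ev_dx w V e x y HV Hy) as [H1 H2].
  unfold d_x; rewrite (surjective_pairing (ev V (D_x e) x y)).
  f_equal; apply is_derive_unique;
    [revert H1 | revert H2]; apply is_derive_ext; intros t; now rewrite Hf.
Qed.

Lemma d_y_ev w V f e x y : jets w V ->
  (forall x y, Rabs y < w -> f x y = ev V e x y) -> Rabs y < w ->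
  d_y f x y = ev V (D_y e) x y.
Proof.
  intros HV Hf Hy; destruct (ev_dy w V e x y HV Hy) as [H1 H2].
  unfold d_y; rewrite (surjective_pairing (ev V (D_y e) x y)).
  f_equal; apply is_derive_unique;
    [revert H1 | revert H2]; apply is_derive_ext_loc;
    generalize (strip_locally w y Hy); apply filter_imp; intros t Ht; now rewrite Hf.
Qed.

Lemma d_z_ev w V f e x y : jets w V ->
  (forall x y, Rabs y < w -> f x y = ev V e x y) -> Rabs y < w ->
  d_z f x y = ev V (D_z e) x y.
Proof.
  intros HV Hf Hy; unfold d_z.
  now rewrite (d_x_ev w V f e x y), (d_y_ev w V f e x y), D_z_xy.
Qed.

Lemma dpoly_at_ev w u P x y : strip_smooth w u -> Rabs y < w ->
  dpoly_at u P x y = ev (jets_of u) (to_dexpr P) x y.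
Proof.
  intros Hu Hy; rewrite ev_to_dexpr; unfold dpoly_at; f_equal; extensionality k.
  assert (HV := jets_of_jets w u Hu).
  revert x y Hy; induction k as [|k IH]; intros x y Hy.
  - change (d_z (fun s t => RtoC (u s t)) x y = ev (jets_of u) uz x y).
    rewrite (d_z_ev w (jets_of u) _ (Atm (J 0 0 0)) x y HV); trivial.
  - now apply (d_z_ev w (jets_of u) _ (zjet k)).
Qed.

Lemma ev_smooth w V e y (L : C -> R) :
  L = Re \/ L = Im -> jets w V -> Rabs y < w ->
  forall n x, Derive_n (fun x => L (ev V e x y)) n x
              = L (ev V (Nat.iter n (D shift_x) e) x y) /\
              ex_derive_n (fun x => L (ev V e x y)) n x.
Proof.
  intros HL HV Hy.
  assert (H : forall e x, is_derive (fun x => L (ev V e x y)) x (L (ev V (D_x e) x y))).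
  { intros e' x; destruct (ev_dx w V e' x y HV Hy); destruct HL as [-> | ->]; assumption. }
  assert (E : forall n x, Derive_n (fun x => L (ev V e x y)) n x
              = L (ev V (Nat.iter n (D shift_x) e) x y)).
  { induction n as [|n IH]; intros x; [reflexivity|]; simpl.
    rewrite (Derive_ext _ _ x IH); apply is_derive_unique, H. }
  intros n x; split; [apply E|]; destruct n as [|n]; [exact I|]; simpl.
  apply (ex_derive_ext (fun x => L (ev V (Nat.iter n (D shift_x) e) x y))).
  - intros t; now rewrite E.
  - eexists; apply H.
Qed.

(** * Straight lines in the space of Cauchy data *)

(** The jets of [q + t dq] and [r + t dr] as functions of [(x, t)]; they are affine
in [t]. *)
Definition line_env (q r dq dr : R -> R) : env := fun i j k x t =>
  let f := match i with O => q | S _ => r end in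
  let df := match i with O => dq | S _ => dr end in
  match k with
  | O => Derive_n f j x + t * Derive_n df j x
  | 1%nat => Derive_n df j x
  | _ => 0
  end.

Lemma Derive_n_step f j x : (forall n x, ex_derive_n f n x) ->
  is_derive (Derive_n f j) x (Derive_n f (S j) x).
Proof. intros H; apply Derive_correct, (H (S j)). Qed.

Lemma line_env_jets p w q r dq dr :
  smooth_periodic p q -> smooth_periodic p r ->
  smooth_periodic p dq -> smooth_periodic p dr ->
  jets w (line_env q r dq dr).
Proof.
  intros [Hq _] [Hr _] [Hdq _] [Hdr _] i j k x y _; unfold line_env.
  set (f := match i with O => q | S _ => r end).
  set (df := match i with O => dq | S _ => dr end).
  assert (Hf : forall n x, ex_derive_n f n x) by (destruct i; assumption).
  assert (Hdf : forall n x, ex_derive_n df n x) by (destruct i; assumption).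
  assert (F := Derive_n_step f j x Hf); assert (DF := Derive_n_step df j x Hdf).
  destruct k as [|[|k]]; split; try (apply @is_derive_const).
  - apply @is_derive_plus; [exact F|].
    now apply (is_derive_scal (Derive_n df j) x y).
  - auto_derive; [exact I | ring].
  - exact DF.
Qed.

Lemma line_env_continuous p q r dq dr i j k x t :
  smooth_periodic p q -> smooth_periodic p r ->
  smooth_periodic p dq -> smooth_periodic p dr ->
  continuity_2d_pt (fun t x => line_env q r dq dr i j k x t) t x.
Proof.
  intros [Hq _] [Hr _] [Hdq _] [Hdr _]; unfold line_env.
  set (f := match i with O => q | S _ => r end).
  set (df := match i with O => dq | S _ => dr end).
  assert (Hf : forall n x, ex_derive_n f n x) by (destruct i; assumption).
  assert (Hdf : forall n x, ex_derive_n df n x) by (destruct i; assumption).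
  assert (C : forall f, (forall n x, ex_derive_n f n x) ->
            continuity_2d_pt (fun _ x => Derive_n f j x) t x).
  { intros g Hg; apply (continuity_1d_2d_pt_comp (Derive_n g j) (fun _ x => x));
      [|apply continuity_2d_pt_id2].
    apply continuity_pt_filterlim, (ex_derive_continuous (Derive_n g j)).
    eexists; now apply Derive_n_step. }
  destruct k as [|[|k]]; [| now apply C | apply continuity_2d_pt_const].
  apply continuity_2d_pt_plus; [now apply C|].
  apply continuity_2d_pt_mult; [apply continuity_2d_pt_id1 | now apply C].
Qed.

Lemma Derive_n_periodic p f j : periodic p f -> periodic p (Derive_n f j).
Proof.
  intros H; induction j as [|j IH]; [exact H|].
  intros x; now apply Derive_periodic.
Qed.

Lemma line_env_periodic p q r dq dr i j k x t :
  smooth_periodic p q -> smooth_periodic p r ->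
  smooth_periodic p dq -> smooth_periodic p dr ->
  line_env q r dq dr i j k (x + p) t = line_env q r dq dr i j k x t.
Proof.
  intros [_ Hq] [_ Hr] [_ Hdq] [_ Hdr]; unfold line_env.
  destruct i; rewrite !(Derive_n_periodic p _ j) by assumption; reflexivity.
Qed.

Lemma ev_continuous_2d V e x t :
  (forall i j k, continuity_2d_pt (fun t x => V i j k x t) t x) ->
  continuity_2d_pt (fun t x => Re (ev V e x t)) t x /\
  continuity_2d_pt (fun t x => Im (ev V e x t)) t x.
Proof.
  intros HV.
  assert (Hd : continuity_2d_pt (fun t x => 2 * V 0%nat 0%nat 0%nat x t) t x).
  { apply continuity_2d_pt_mult; [apply continuity_2d_pt_const | apply HV]. }
  induction e as [a|[i j k| |]|e IHe f IHf|e IHe f IHf]; simpl.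
  - split; apply continuity_2d_pt_const.
  - split; [apply HV | apply continuity_2d_pt_const].
  - split; [|apply continuity_2d_pt_const].
    apply (continuity_1d_2d_pt_comp cosh); [|exact Hd].
    apply continuity_pt_filterlim, (ex_derive_continuous cosh).
    eexists; apply is_derive_cosh.
  - split; [|apply continuity_2d_pt_const].
    apply (continuity_1d_2d_pt_comp sinh); [|exact Hd].
    apply continuity_pt_filterlim, (ex_derive_continuous sinh).
    eexists; apply is_derive_sinh.
  - destruct IHe, IHf; split; now apply continuity_2d_pt_plus.
  - destruct IHe, IHf; split.
    + now apply continuity_2d_pt_minus; apply continuity_2d_pt_mult.
    + now apply continuity_2d_pt_plus; apply continuity_2d_pt_mult.
Qed.
(** * The gradient *)

Lemma ev_continuous_x w V e x y (L : C -> R) :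
  L = Re \/ L = Im -> jets w V -> Rabs y < w ->
  continuous (fun x => L (ev V e x y)) x.
Proof.
  intros HL HV Hy; apply (ex_derive_continuous (fun x => L (ev V e x y))).
  exists (L (ev V (D_x e) x y)).
  destruct (ev_dx w V e x y HV Hy), HL as [-> | ->]; assumption.
Qed.

Lemma RInt_C (f : R -> C) a b :
  ex_RInt (fun x => Re (f x)) a b -> ex_RInt (fun x => Im (f x)) a b ->
  RInt (V := C_R_CompleteNormedModule) f a b =
  (RInt (fun x => Re (f x)) a b, RInt (fun x => Im (f x)) a b).
Proof.
  intros H1 H2; apply (is_RInt_unique (V := C_R_CompleteNormedModule)).
  apply (is_RInt_fct_extend_pair (U := R_NormedModule) (V := R_NormedModule));
    now apply (RInt_correct (V := R_CompleteNormedModule)).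
Qed.

Lemma pow_neg1_sqr n : (-1) ^ n * (-1) ^ n = 1.
Proof. rewrite <- Rpow_mult_distr; replace (-1 * -1) with 1 by ring; apply pow1. Qed.

Lemma RtoC_pow_neg1 n : ((-1) ^ n)%C = RtoC ((-1) ^ n).
Proof. induction n as [|n IH]; simpl; [reflexivity|]; now rewrite IH, RtoC_mult. Qed.

Section Gradient.

Variables (p eps : R) (u : R -> R -> R) (q r dq dr : R -> R).
Variables (omega phi : nat -> dpoly) (g h : dseries) (n : nat).
Hypothesis Heps : 0 < eps.
Hypothesis (Hq : smooth_periodic p q) (Hr : smooth_periodic p r).
Hypothesis (Hdq : smooth_periodic p dq) (Hdr : smooth_periodic p dr).
Hypothesis Hu : sinh_gordon_solution p eps u.
Hypothesis Hc : is_cauchy_data u q r.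
Hypothesis HPS : pinkall_sterling omega phi.
Hypothesis Hg : riccati Ci ricP ricL ricR g.
Hypothesis Hh : adjoint g h.

Let U := jets_of u.
Let V := line_env q r dq dr.
Let om := fun x => ev U (to_dexpr (omega n)) x 0.
Let om_y := fun x => ev U (D_y (to_dexpr (omega n))) x 0.

Lemma solution_smooth : strip_smooth eps u.
Proof. intros k x y Hy; apply (Hu x y Hy). Qed.

Lemma solution_env : sinh_gordon_env eps U.
Proof.
  split; [apply jets_of_jets, solution_smooth | split].
  - reflexivity.
  - intros x y Hy; apply (Hu x y Hy).
Qed.

Lemma abs_0_lt : Rabs 0 < eps.
Proof. now rewrite Rabs_R0. Qed.

Lemma line_jets w : jets w V.
Proof. now apply line_env_jets with p. Qed.

(** On the Cauchy data both frames solve the same Lax equation along [x]. *)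
Lemma frames_agree x k :
  ev V (frameA g h k) x 0 = ev U (sA omega phi k) x 0 /\
  ev V (frameB g h k) x 0 = ev U (sB omega k) x 0 /\
  ev V (frameC g h k) x 0 = ev U (sC omega k) x 0.
Proof.
  assert (E : forall x, V 0%nat 0%nat 0%nat x 0 = U 0%nat 0%nat 0%nat x 0
    /\ V 0%nat 1%nat 0%nat x 0 = U 0%nat 1%nat 0%nat x 0
    /\ V 1%nat 0%nat 0%nat x 0 = U 1%nat 0%nat 0%nat x 0).
  { intros t; unfold V, U, line_env, jets_of; simpl; repeat split.
    - destruct (Hc t) as [-> _]; ring.
    - rewrite Rmult_0_l, Rplus_0_r; apply Derive_ext; intros s; apply Hc.
    - destruct (Hc t) as [_ ->]. unfold dY; ring. }
  assert (F1 := frame_is_lax_frame g h Hg Hh eps V 0 (line_jets eps) abs_0_lt).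
  assert (F2 := solution_is_lax_frame omega phi HPS eps U solution_env Heps).
  replace (fun x => ev V uz x 0) with (fun x => ev U uz x 0) in F1.
  2:{ extensionality t; cbn [ev uz ev_atom]; destruct (E t) as (_ & -> & ->); reflexivity. }
  replace (fun x => ev V (Atm Ch) x 0) with (fun x => ev U (Atm Ch) x 0) in F1.
  2:{ extensionality t; cbn [ev uz ev_atom]; destruct (E t) as (-> & _); reflexivity. }
  replace (fun x => ev V (Atm Sh) x 0) with (fun x => ev U (Atm Sh) x 0) in F1.
  2:{ extensionality t; cbn [ev uz ev_atom]; destruct (E t) as (-> & _); reflexivity. }
  exact (lax_frame_unique _ _ _ _ _ _ _ _ _ F1 F2 x k).
Qed.

Lemma sB_odd : sB omega (2 * n + 1)%nat = Times (Con (2 * Ci * (-1) ^ n)%C) (to_dexpr (omega n)).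
Proof.
  unfold sB, hatB.
  replace (Nat.odd (2 * n + 1)%nat) with true
    by now rewrite Nat.odd_add, Nat.odd_mul.
  replace (Nat.div2 (2 * n + 1)%nat) with n; [reflexivity|].
  rewrite Nat.add_1_r; symmetry; apply Nat.div2_succ_double.
Qed.

(** The first variation in the form of the symplectic pairing.  The term
[- dq_x B / 2] from [delta u_z] is integrated by parts, and [B_zb] is expressed
through [A] and [C] by the flow in the direction [zb]; up to the
factor [(-1)^n], the coefficient of [dq] is then [i (omega_z - omega_zb)], the
[y]-derivative of [omega]. *)
Lemma variation_density : exists T T' : R -> C,
  (forall x, cder T x (T' x)) /\ (forall x, T (x + p) = T x) /\
  (forall x, ev V (D_y (diag11 g (2 * n + 2)%nat)) x 0 =
     (T' x + (-1) ^ (n + 1) * (om x * dr x - dq x * om_y x))%C).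
Proof.
  set (W := smul h (Ds shift_y g) (2 * n + 1)%nat).
  exists (fun x => ev V W x 0 + (- Ci * (-1) ^ n) * (dq x * om x))%C.
  exists (fun x => ev V (D_x W) x 0
    + (0 * (dq x * om x)
       + (- Ci * (-1) ^ n)
         * (Derive dq x * om x + dq x * ev U (D_x (to_dexpr (omega n))) x 0)))%C.
  split; [|split]; intros x.
  - apply cder_plus; [apply (ev_dx eps); [apply line_jets | apply abs_0_lt]|].
    apply (cder_mult (fun _ => (- Ci * (-1) ^ n)%C) (fun x => dq x * om x)%C);
      [apply cder_const|].
    apply (cder_mult (fun x => RtoC (dq x)) om).
    + apply cder_real; exact (Derive_n_step dq 0 x (proj1 Hdq)).
    + apply (ev_dx eps); [apply solution_env | apply abs_0_lt].
  - rewrite (ev_periodic V p)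
      by (intros; now apply line_env_periodic).
    unfold om; rewrite (ev_periodic U p).
    + destruct Hdq as [_ Pdq]; now rewrite Pdq.
    + intros i j k t; apply (jets_of_periodic eps); [|apply abs_0_lt].
      intros s y Hy; apply (Hu s y Hy).
  - assert (E := f_equal (fun F : ps => F (S (2 * n + 1)%nat))
                   (first_variation g h Hg Hh V x 0)).
    cbv beta in E; rewrite pmul_var_S in E.
    replace (S (2 * n + 1)%nat) with (2 * n + 2)%nat in E by lia.
    change (evs V (Ds shift_y (diag11 g)) x 0 (2 * n + 2)%nat)
      with (ev V (D_y (diag11 g (2 * n + 2)%nat)) x 0) in E.
    rewrite E; clear E.
    set (ch := ev U (Atm Ch) x 0); set (sh := ev U (Atm Sh) x 0).
    destruct (zb_flow omega phi HPS eps U solution_env x 0 abs_0_lt) as (_ & ZB & _).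
    destruct (evs_res omega phi U x 0) as (_ & RB & _).
    rewrite RB in ZB; clear RB.
    assert (EB : (evs U (Ds shift_zb (sB omega)) x 0 =
      - ('I * 's * (pconst sh * evs U (sA omega phi) x 0
                    + pconst ch * evs U (sC omega) x 0)))%ps).
    { etransitivity; [|etransitivity; [apply (f_equal (fun F => (F - 'I * 's *
        (pconst sh * evs U (sA omega phi) x 0
         + pconst ch * evs U (sC omega) x 0))%ps) ZB)|]]; unfold sh, ch; ring. }
    assert (FA : evs V (frameA g h) x 0 = evs U (sA omega phi) x 0)
      by (extensionality k; apply frames_agree).
    assert (FB : evs V (frameB g h) x 0 = evs U (sB omega) x 0)
      by (extensionality k; apply frames_agree).
    assert (FC : evs V (frameC g h) x 0 = evs U (sC omega) x 0)
      by (extensionality k; apply frames_agree).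
    rewrite FA, FB, FC.
    assert (E0 : V 0%nat 0%nat 0%nat x 0 = U 0%nat 0%nat 0%nat x 0).
    { unfold V, U, line_env, jets_of; simpl; destruct (Hc x) as [-> _]; ring. }
    assert (Ech : ev V (Atm Ch) x 0 = ch) by (unfold ch; cbn [ev ev_atom]; now rewrite E0).
    assert (Esh : ev V (Atm Sh) x 0 = sh) by (unfold sh; cbn [ev ev_atom]; now rewrite E0).
    rewrite Ech, Esh.
    change (V 0%nat 0%nat 1%nat x 0) with (dq x).
    match goal with |- padd (padd ?X1 (popp (pmul ?X2 ?X3))) ?X4 _ = _ =>
      assert (E : (X1 - X2 * X3 + X4 = X1 - X2 * X3
        - pconst (dq x) * evs U (Ds shift_zb (sB omega)) x 0)%ps)
    end.
    { rewrite EB; ring. }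
    rewrite E; unfold padd, popp; rewrite !pmul_const_l.
    unfold evs, Ds; rewrite sB_odd.
    change (ev V (D shift_x (smul h (fun k => D_y (g k)) (2 * n + 1)%nat)) x 0)
      with (ev V (D_x W) x 0).
    unfold om_y; rewrite (ev_D_y U).
    assert (Hx : ev U (D_x (to_dexpr (omega n))) x 0
      = (ev U (D_z (to_dexpr (omega n))) x 0 + ev U (D_zb (to_dexpr (omega n))) x 0)%C).
    { rewrite D_z_xy, D_zb_xy; field. }
    assert (Huz : ev V (D_y uz) x 0 = (/ 2 * (Derive dq x - Ci * dr x))%C).
    { unfold uz; cbn [D ev vfield shift_y ev_atom].
      change (V 0%nat 1%nat 1%nat x 0) with (Derive dq x).
      change (V 1%nat 0%nat 1%nat x 0) with (dr x); ring. }
    rewrite Hx, Huz; unfold om; cbn [D ev].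
    rewrite Nat.add_1_r; change ((-1) ^ S n)%C with ((-1) * (-1) ^ n)%C.
    set (o := ev U (to_dexpr (omega n)) x 0).
    set (oz := ev U (D_z (to_dexpr (omega n))) x 0).
    set (ob := ev U (D_zb (to_dexpr (omega n))) x 0).
    set (e := ((-1) ^ n)%C).
    transitivity (ev V (D_x W) x 0 - Ci * e * (Derive dq x * o)
      + (Ci * Ci) * e * dr x * o - 2 * Ci * e * dq x * ob)%C; [field|].
    rewrite Ci_sqr; ring.
Qed.

Lemma om_continuous (L : C -> R) x : L = Re \/ L = Im ->
  continuous (fun x => L (om x)) x /\ continuous (fun x => L (om_y x)) x.
Proof.
  intros HL; split; apply (ev_continuous_x eps); trivial;
    first [apply solution_env | apply abs_0_lt].
Qed.

Lemma smooth_periodic_continuous f x : smooth_periodic p f -> continuous f x.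
Proof. intros [Hf _]; apply (ex_derive_continuous f), (Hf 1%nat). Qed.

Lemma variation_integral (L : C -> R) : L = Re \/ L = Im ->
  RInt (fun x => L (ev V (D_y (diag11 g (2 * n + 2)%nat)) x 0)) 0 p =
  (-1) ^ (n + 1) * Omega p (fun x => L (om x)) (fun x => L (om_y x)) dq dr.
Proof.
  intros HL; destruct variation_density as (T & T' & HT & PT & ET).
  assert (ET0 : T p = T 0) by (rewrite <- (PT 0), Rplus_0_l; reflexivity).
  set (e := diag11 g (2 * n + 2)%nat) in *.
  set (d := fun x => L (om x) * dr x - dq x * L (om_y x)).
  assert (EL : forall x, L (ev V (D_y e) x 0) = L (T' x) + (-1) ^ (n + 1) * d x).
  { intros x; rewrite ET, RtoC_pow_neg1; unfold d.
    destruct HL as [-> | ->]; unfold Re, Im; simpl; ring. }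
  assert (EL' : forall x, L (ev V (D_y e) x 0) - (-1) ^ (n + 1) * d x = L (T' x))
    by (intros x; rewrite EL; ring).
  assert (Cd : forall x, continuous d x).
  { intros x; destruct (om_continuous L x HL) as [C1 C2].
    apply (continuous_minus (V := R_NormedModule) (fun x => L (om x) * dr x)
             (fun x => dq x * L (om_y x)));
      apply (continuous_mult (K := R_AbsRing));
      trivial; now apply smooth_periodic_continuous. }
  assert (I1 : is_RInt d 0 p (RInt d 0 p)).
  { apply (RInt_correct (V := R_CompleteNormedModule)).
    apply (ex_RInt_continuous (V := R_CompleteNormedModule)); intros; apply Cd. }
  assert (I2 : is_RInt (fun x => L (T' x)) 0 p 0).
  { replace 0 with (minus (G := R_AbelianGroup) (L (T p)) (L (T 0))) at 2.
    2:{ rewrite ET0; apply (minus_eq_zero (G := R_AbelianGroup)). }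
    apply (is_RInt_derive (V := R_CompleteNormedModule) (fun x => L (T x))).
    - intros x _; destruct (HT x), HL as [-> | ->]; assumption.
    - intros x _.
      apply (continuous_ext (fun x => L (ev V (D_y e) x 0) - (-1) ^ (n + 1) * d x)).
      + exact EL'.
      + apply (continuous_minus (V := R_NormedModule)
                 (fun x => L (ev V (D_y e) x 0)) (fun x => (-1) ^ (n + 1) * d x)).
        * apply (ev_continuous_x eps); [exact HL | apply line_jets | apply abs_0_lt].
        * apply (continuous_mult (K := R_AbsRing)); [apply continuous_const | apply Cd]. }
  apply is_RInt_unique.
  apply (is_RInt_ext (fun x => L (T' x) + (-1) ^ (n + 1) * d x));
    [intros x _; now rewrite EL|].
  replace ((-1) ^ (n + 1) * _) with (0 + (-1) ^ (n + 1) * RInt d 0 p)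
    by (unfold Omega, d; ring).
  apply (is_RInt_plus (V := R_NormedModule) (fun x => L (T' x))
           (fun x => (-1) ^ (n + 1) * d x)); [exact I2|].
  now apply (is_RInt_scal (V := R_NormedModule) d 0 p ((-1) ^ (n + 1))).
Qed.

Lemma functional_derivative (L : C -> R) : L = Re \/ L = Im ->
  is_derive (fun t => (-1) ^ (n + 1)
       * RInt (fun x => L (ev V (diag11 g (2 * n + 2)%nat) x t)) 0 p) 0
    (Omega p (fun x => L (om x)) (fun x => L (om_y x)) dq dr).
Proof.
  intros HL; set (e := diag11 g (2 * n + 2)%nat).
  assert (Dt : forall t x, is_derive (fun t => L (ev V e x t)) t (L (ev V (D_y e) x t))).
  { intros t x; assert (Ht : Rabs t < Rabs t + 1) by lra.
    destruct (ev_dy _ V e x t (line_jets _) Ht), HL as [-> | ->]; assumption. }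
  replace (Omega p _ _ dq dr) with ((-1) ^ (n + 1)
      * RInt (fun x => L (ev V (D_y e) x 0)) 0 p).
  2:{ unfold e; rewrite (variation_integral L HL), <- Rmult_assoc, pow_neg1_sqr; ring. }
  apply (is_derive_scal (fun t => RInt (fun x => L (ev V e x t)) 0 p)).
  replace (RInt (fun x => L (ev V (D_y e) x 0)) 0 p)
    with (RInt (fun x => Derive (fun t => L (ev V e x t)) 0) 0 p).
  2:{ apply RInt_ext; intros x _; apply is_derive_unique, Dt. }
  apply (is_derive_RInt_param (fun t x => L (ev V e x t))).
  - apply filter_forall; intros t x _; eexists; apply Dt.
  - intros x _; apply (continuity_2d_pt_ext (fun t x => L (ev V (D_y e) x t))).
    + intros s y; symmetry; apply is_derive_unique, Dt.
    + assert (CV : forall i j k, continuity_2d_pt (fun t x => V i j k x t) 0 x)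
        by (intros; now apply line_env_continuous with p).
      destruct (ev_continuous_2d V (D_y e) x 0 CV), HL as [-> | ->]; assumption.
  - apply filter_forall; intros t.
    apply (ex_RInt_continuous (V := R_CompleteNormedModule)); intros x _.
    assert (Ht : Rabs t < Rabs t + 1) by lra.
    exact (ev_continuous_x _ V e x t L HL (line_jets _) Ht).
Qed.

End Gradient.

Theorem theorem8p6 :
  forall (p eps : R) (u : R -> R -> R) (q r : R -> R)
         (omega phi : nat -> dpoly) (c : nat -> (R -> R) -> (R -> R) -> C),
    0 < p -> 0 < eps ->
    smooth_periodic p q -> smooth_periodic p r ->
    sinh_gordon_solution p eps u ->
    is_cauchy_data u q r ->
    finite_type p q r ->
    hamiltonian_coefficients p c ->
    pinkall_sterling omega phi ->
    forall n : nat,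
      is_gradient p (hamiltonian c (2 * n + 1)) q r
        (fun x => Re (dpoly_at u (omega n) x 0))
        (fun x => Re (d_y (dpoly_at u (omega n)) x 0)) /\
      is_gradient p (hamiltonian c (2 * n + 2)) q r
        (fun x => Im (dpoly_at u (omega n) x 0))
        (fun x => Im (d_y (dpoly_at u (omega n)) x 0)).
Proof.
  intros p eps u q r omega phi c _ Heps Hq Hr Hu Hc _ Hham HPS n.
  destruct (riccati_exists Ci ricP ricL ricR) as [g Hg].
  destruct (riccati_exists (- Ci) (sscal (-1) ricR) (sscal (-1) ricL) (sscal (-1) ricP))
    as [a Ha].
  destruct (riccati_exists (- Ci) (fun _ => Con 0)
              (sscal (-1) (sadd ricL (sscal 2 (smul ricP g)))) ricP) as [h Hh].
  assert (Hs : strip_smooth eps u) by (intros k x y Hy; apply (Hu x y Hy)).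
  assert (H0 : Rabs 0 < eps) by now rewrite Rabs_R0.
  assert (HJ := jets_of_jets eps u Hs).
  replace (fun x => Re (dpoly_at u (omega n) x 0))
    with (fun x => Re (ev (jets_of u) (to_dexpr (omega n)) x 0))
    by (extensionality x; now rewrite (dpoly_at_ev eps)).
  replace (fun x => Im (dpoly_at u (omega n) x 0))
    with (fun x => Im (ev (jets_of u) (to_dexpr (omega n)) x 0))
    by (extensionality x; now rewrite (dpoly_at_ev eps)).
  assert (Ey : forall x, d_y (dpoly_at u (omega n)) x 0
                         = ev (jets_of u) (D_y (to_dexpr (omega n))) x 0).
  { intros x; apply (d_y_ev eps); trivial.
    intros s y Hy; now apply (dpoly_at_ev eps). }
  replace (fun x => Re (d_y (dpoly_at u (omega n)) x 0))
    with (fun x => Re (ev (jets_of u) (D_y (to_dexpr (omega n))) x 0))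
    by (extensionality x; now rewrite Ey).
  replace (fun x => Im (d_y (dpoly_at u (omega n)) x 0))
    with (fun x => Im (ev (jets_of u) (D_y (to_dexpr (omega n))) x 0))
    by (extensionality x; now rewrite Ey).
  assert (SP : forall e (L : C -> R), L = Re \/ L = Im ->
                 smooth_periodic p (fun x => L (ev (jets_of u) e x 0))).
  { intros e L HL; split.
    - intros k x; now apply (ev_smooth eps).
    - intros x; f_equal; apply ev_periodic; intros i j k s.
      apply (jets_of_periodic eps); [|exact H0]; intros; now apply Hu. }
  assert (Ec : forall dq dr t, smooth_periodic p dq -> smooth_periodic p dr ->
    let V := line_env q r dq dr in
    c n (fun x => q x + t * dq x) (fun x => r x + t * dr x)
    = (RInt (fun x => Re (ev V (diag11 g (2 * n + 2)%nat) x t)) 0 p,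
       RInt (fun x => Im (ev V (diag11 g (2 * n + 2)%nat) x t)) 0 p)).
  { intros dq dr t Hdq Hdr V.
    assert (HV : forall w, jets w V) by (intros; now apply line_env_jets with p).
    assert (Ht : Rabs t < Rabs t + 1) by lra.
    assert (SPL : forall f df, smooth_periodic p f -> smooth_periodic p df ->
              smooth_periodic p (fun x => f x + t * df x)).
    { intros f df [Hf Pf] [Hdf Pdf]; split.
      - intros k x; apply ex_derive_n_plus.
        + apply filter_forall; intros; apply Hf.
        + apply filter_forall; intros y j _; apply ex_derive_n_scal_l, Hdf.
      - intros x; now rewrite Pf, Pdf. }
    destruct (Hham _ _ (SPL q dq Hq Hdq) (SPL r dr Hr Hdr)) as [_ Hb].
    rewrite (Hb _ _ (formal_diagonalization_jets _ V t g a (HV _) Ht Hg Ha) n).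
    rewrite <- RInt_C.
    - apply (RInt_ext (V := C_R_CompleteNormedModule)); intros x _; apply entry_mat2; lia.
    - apply (ex_RInt_continuous (V := R_CompleteNormedModule)); intros x _.
      exact (ev_continuous_x _ V _ x t Re (or_introl eq_refl) (HV _) Ht).
    - apply (ex_RInt_continuous (V := R_CompleteNormedModule)); intros x _.
      exact (ev_continuous_x _ V _ x t Im (or_intror eq_refl) (HV _) Ht). }
  assert (D1 : Nat.div2 (2 * n + 1 - 1) = n).
  { replace (2 * n + 1 - 1)%nat with (2 * n)%nat by lia; apply Nat.div2_double. }
  assert (D2 : Nat.div2 (2 * n + 2 - 1) = n).
  { replace (2 * n + 2 - 1)%nat with (S (2 * n)) by lia; apply Nat.div2_succ_double. }
  assert (O1 : Nat.odd (2 * n + 1) = true) by now rewrite Nat.odd_add, Nat.odd_mul.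
  assert (O2 : Nat.odd (2 * n + 2) = false) by now rewrite Nat.odd_add, Nat.odd_mul.
  split; (split; [apply SP; auto|split; [apply SP; auto|]]); intros dq dr Hdq Hdr;
    unfold hamiltonian.
  - rewrite D1, O1.
    apply (is_derive_ext (fun t => (-1) ^ (n + 1) * RInt (fun x => Re
      (ev (line_env q r dq dr) (diag11 g (2 * n + 2)%nat) x t)) 0 p));
      [intros t; now rewrite Ec|].
    apply (functional_derivative p eps u q r dq dr omega phi g h n); auto.
  - rewrite D2, O2.
    apply (is_derive_ext (fun t => (-1) ^ (n + 1) * RInt (fun x => Im
      (ev (line_env q r dq dr) (diag11 g (2 * n + 2)%nat) x t)) 0 p));
      [intros t; now rewrite Ec|].
    apply (functional_derivative p eps u q r dq dr omega phi g h n); auto.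
Qed.
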